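(* Every finitely generated indecomposable RA loop is isomorphic to a loop $M(G,*,g_o)$ of one of the following sixteen types. In each type $D=\langle x,y,Z(D)\rangle$ is a group with center $Z(D)$ as listed, with $D/Z(D)\cong C_2\times C_2$, generated modulo $Z(D)$ by $x$ and $y$, with $[x,y]=x^{-1}y^{-1}xy=t_1^{2^{m_1-1}}$ and with $x^2,y^2$ as listed; $o(t_i)=2^{m_i}$ with $m_i\ge 1$ arbitrary integers, $o(u_1)=o(u_2)=\infty$, $o(t)=2^k$ with $k\ge 1$ an arbitrary integer, and $o(w)=\infty$; the group $G$ is either $D$ or the direct product of $D$ with the listed cyclic group; and $u^2=g_o\in Z(G)$ is as listed. (1) $Z(D)=\langle t_1\rangle$, $x^2=1$, $y^2=1$, $G=D$, $g_o=1$. (2) $Z(D)=\langle t_1\rangle$, $x^2=t_1$, $y^2=t_1$, $G=D$, $g_o=t_1$. (3) $Z(D)=\langle t_1\rangle\times\langle t_2\rangle$, $x^2=1$, $y^2=t_2$, $G=D$, $g_o=1$. (4) $Z(D)=\langle t_1\rangle\times\langle t_2\rangle$, $x^2=t_1$, $y^2=t_2$, $G=D$, $g_o=t_1$. (5) $Z(D)=\langle t_1\rangle\times\langle u_1\rangle$, $x^2=1$, $y^2=u_1$, $G=D$, $g_o=1$. (6) $Z(D)=\langle t_1\rangle\times\langle u_1\rangle$, $x^2=t_1$, $y^2=u_1$, $G=D$, $g_o=t_1$. (7) $Z(D)=\langle t_1\rangle\times\langle t_2\rangle\times\langle t_3\rangle$, $x^2=t_2$, $y^2=t_3$, $G=D$,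 $g_o=1$. (8) $Z(D)=\langle t_1\rangle\times\langle t_2\rangle\times\langle t_3\rangle$, $x^2=t_2$, $y^2=t_3$, $G=D$, $g_o=t_1$. (9) $Z(D)=\langle t_1\rangle\times\langle t_2\rangle\times\langle t_3\rangle$, $x^2=t_2$, $y^2=t_3$, $G=D\times\langle t\rangle$, $g_o=t$. (10) $Z(D)=\langle t_1\rangle\times\langle t_2\rangle\times\langle u_1\rangle$, $x^2=t_2$, $y^2=u_1$, $G=D$, $g_o=1$. (11) $Z(D)=\langle t_1\rangle\times\langle t_2\rangle\times\langle u_1\rangle$, $x^2=t_2$, $y^2=u_1$, $G=D$, $g_o=t_1$. (12) $Z(D)=\langle t_1\rangle\times\langle t_2\rangle\times\langle u_1\rangle$, $x^2=t_2$, $y^2=u_1$, $G=D\times\langle t\rangle$, $g_o=t$. (13) $Z(D)=\langle t_1\rangle\times\langle t_2\rangle\times\langle u_1\rangle$, $x^2=t_2$, $y^2=u_1$, $G=D\times\langle w\rangle$, $g_o=w$. (14) $Z(D)=\langle t_1\rangle\times\langle u_1\rangle\times\langle u_2\rangle$, $x^2=u_1$, $y^2=u_2$, $G=D$, $g_o=1$. (15) $Z(D)=\langle t_1\rangle\times\langle u_1\rangle\times\langle u_2\rangle$, $x^2=u_1$, $y^2=u_2$, $G=D$, $g_o=t_1$. (16) $Z(D)=\langle t_1\rangle\times\langle u_1\rangle\times\langle u_2\rangle$, $x^2=u_1$, $y^2=u_2$, $G=D\times\langle w\rangle$, $g_o=w$.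
   Context: A loop is a nonempty set $L$ with a binary operation having a two-sided identity element $1$ and such that in $a\cdot b=c$ any two of the three elements uniquely determine the third. An RA (ring alternative) loop is a loop whose loop ring over some commutative associative ring with unity and of characteristic different from $2$ is alternative (i.e. satisfies $(xx)y=x(xy)$ and $(yx)x=y(xx)$) but not associative. A loop is indecomposable if it is not a direct product of proper subloops. $C_2$ is the cyclic group of order $2$, $o(\cdot)$ denotes the order of an element, and $Z(\cdot)$ denotes the center. Construction of $M(G,*,g_o)$: let $G$ be a nonabelian group with $G/Z(G)\cong C_2\times C_2$; then its commutator subgroup is $G'=\{1,s\}\subseteq Z(G)$ for some $s$ of order $2$. Let $*$ be the involution of $G$ given by $g^*=g$ if $g\in Z(G)$ and $g^*=sg$ if $g\notin Z(G)$. Let $g_o\in Z(G)$. Then $M(G,*,g_o)$ is the loop with underlying set the disjoint union $G\cup Gu$, where $u$ is an indeterminate, whose operation extends that of $G$ by $$g(hu)=(hg)u,\qquad (gu)h=(gh^* )u,\qquad (gu)(hu)=g_oh^*g\qquad (g,h\in G);$$ in particular $u^2=g_o$. It is known that every such $M(G,*,g_o)$ is an RA loop and that every RA loop is of this form. *)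

(* Defs.v *)
From HB Require Import structures.
From mathcomp Require Import all_boot all_algebra.
From mathcomp Require Import finmap.
From mathcomp Require Import boolp classical_sets functions cardinality.
From mathcomp.multinomials Require Import monalg.

Set Implicit Arguments.
Unset Strict Implicit.
Unset Printing Implicit Defensive.

Import GRing.Theory.
Local Open Scope classical_set_scope.
Local Open Scope group_scope.

(* The identity element is part of [umagmaType]. *)
Definition is_loop (L : umagmaType) : Prop :=
  (forall a b : L, exists! c, a * b = c) /\
  (forall a c : L, exists! b, a * b = c) /\
  (forall b c : L, exists! a, a * b = c).

Definition subloop (L : umagmaType) (A : set L) : Prop :=
  [/\ A 1,
      forall a b, A a -> A b -> A (a * b),
      forall a b, A a -> A (a * b) -> A b
    & forall a b, A b -> A (a * b) -> A a].

Definition loop_fin_gen (L : umagmaType) : Prop :=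
  exists2 S : set L, finite_set S & smallest (@subloop L) S = setT.

(* C is the internal direct product of A and B: multiplication is a
   multiplicative bijection from A x B, with componentwise product, onto C.
   Used both for subloops and for subgroups. *)
Definition internal_dprod (M : umagmaType) (A B C : set M) : Prop :=
  set_bij (A `*` B) C (fun p => p.1 * p.2) /\
  (forall a a' b b', A a -> A a' -> B b -> B b' ->
     (a * b) * (a' * b') = (a * a') * (b * b')).

Definition loop_indecomposable (L : umagmaType) : Prop :=
  ~ exists A B : set L,
      [/\ subloop A, subloop B, A <> setT, B <> setT
        & internal_dprod A B setT].

Definition loop_isomorphic (L M : umagmaType) : Prop :=
  exists2 f : L -> M, bijective f & forall a b, f (a * b) = f a * f b.

(* The loop ring RL is the free R-module {malg R[L]}; monalg only provides the
   product for associative L, so it is redefined here by the same formula. *)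
Definition loop_ring_mul (L : umagmaType) (R : comNzRingType)
    (a b : {malg R[L]}) : {malg R[L]} :=
  (\sum_(g <- msupp a) \sum_(h <- msupp b)
     << (a@_g * b@_h)%R *g (g * h)%g >>)%R.

Definition loop_ring_alternative (L : umagmaType) (R : comNzRingType) : Prop :=
  forall x y : {malg R[L]},
    loop_ring_mul (loop_ring_mul x x) y = loop_ring_mul x (loop_ring_mul x y) /\
    loop_ring_mul (loop_ring_mul y x) x = loop_ring_mul y (loop_ring_mul x x).

Definition loop_ring_associative (L : umagmaType) (R : comNzRingType) : Prop :=
  associative (@loop_ring_mul L R).

Definition RA_loop (L : umagmaType) : Prop :=
  is_loop L /\
  exists R : comNzRingType,
    [/\ 2 \notin [pchar R]%R, loop_ring_alternative L R
      & ~ loop_ring_associative L R].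

(* Groups may be infinite, so the finite-group library does not apply; subgroups
   are represented by sets. *)

Definition subgroup (G : groupType) (A : set G) : Prop :=
  [/\ A 1, forall g h, A g -> A h -> A (g * h) & forall g, A g -> A g^-1].

Definition generated (G : groupType) (S : set G) : set G :=
  smallest (@subgroup G) S.

Definition cyclic_subgroup (G : groupType) (g : G) : set G :=
  generated [set g].

Definition center (G : groupType) (A : set G) : set G :=
  [set z | A z /\ forall g, A g -> z * g = g * z].

Definition derived (G : groupType) (A : set G) : set G :=
  generated [set [~ g, h] | g in A & h in A].

(* The library's #[g] is for finite groups only. *)
Definition has_order (G : groupType) (g : G) (n : nat) : Prop :=
  [/\ 0 < n, g ^+ n = 1 & forall k, 0 < k -> g ^+ k = 1 -> n <= k].

Definition has_infinite_order (G : groupType) (g : G) : Prop :=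
  forall k, 0 < k -> g ^+ k <> 1.

Definition has_2power_order (G : groupType) (g : G) (m : nat) : Prop :=
  1 <= m /\ has_order g (2 ^ m)%N.

(* C = <g_1> x (<g_2> x (... x <g_n>)) for gs = [:: g_1; ...; g_n]. *)
Fixpoint cyclic_dprod (G : groupType) (gs : seq G) (C : set G) : Prop :=
  if gs is g :: gs' then
    exists2 B : set G, cyclic_dprod gs' B
                     & internal_dprod (cyclic_subgroup g) B C
  else C = [set 1].

(* The quotient A / N, for N normal in A, as the set of cosets under the
   elementwise product. *)
Definition cosets (G : groupType) (A N : set G) : set (set G) :=
  [set [set g * n | n in N] | g in A].

Definition set_mul (G : groupType) (X Y : set G) : set G :=
  [set x * y | x in X & y in Y].

Definition quotient_isomorphic (G : groupType) (A N : set G) (H : groupType) :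
    Prop :=
  exists2 f : set G -> H, set_bij (cosets A N) setT f &
    forall X Y, cosets A N X -> cosets A N Y -> f (set_mul X Y) = f X * f Y.

(* As a [groupType], 'Z_2 is the additive group of integers mod 2. *)
Definition C2xC2 : groupType := ('Z_2 * 'Z_2)%type.

(* Here s is the nontrivial commutator of G. *)
Definition star (G : groupType) (s g : G) : G :=
  if `[< center setT g >] then g else s * g.

(* M(G,*,g_o): [inl g] stands for g and [inr g] for gu. *)
Definition Mloop (G : groupType) (s go : G) : Type := (G + G)%type.

Section MloopStructure.
Variables (G : groupType) (s go : G).
Local Notation M := (Mloop s go).

Definition Mloop_mul (a b : M) : M :=
  match a, b with
  | inl g, inl h => inl (g * h)
  | inl g, inr h => inr (h * g)
  | inr g, inl h => inr (g * star s h)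
  | inr g, inr h => inl (go * star s h * g)
  end.

Lemma star1 : star s 1 = 1.
Proof.
by rewrite /star asboolT //; split=> // g _; rewrite mul1g mulg1.
Qed.

Lemma Mloop_mul1g : left_id (inl 1 : M) Mloop_mul.
Proof. by case=> g /=; rewrite ?mul1g ?mulg1. Qed.

Lemma Mloop_mulg1 : right_id (inl 1 : M) Mloop_mul.
Proof. by case=> g /=; rewrite ?star1 mulg1. Qed.

HB.instance Definition _ := Choice.copy M (G + G)%type.
HB.instance Definition _ := hasMul.Build M Mloop_mul.
HB.instance Definition _ := Magma_isUMagma.Build M Mloop_mul1g Mloop_mulg1.

End MloopStructure.

(* Under these conditions Mloop s go is a loop. *)
Definition Mloop_datum (G : groupType) (s go : G) : Prop :=
  [/\ exists g h : G, g * h <> h * g,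
      quotient_isomorphic setT (center (@setT G)) C2xC2,
      has_order s 2 /\ center setT s,
      derived (@setT G) = [set 1; s]
    & center setT go].

(* D = <x, y, Z(D)> with Z(D) = <z_1> x ... x <z_n> for zs = [:: z_1; ...; z_n],
   D/Z(D) = C_2 x C_2, [x, y] = t1 ^ (2 ^ (m1 - 1)), x^2 = x2 and y^2 = y2. *)
Definition D_group (G : groupType) (D : set G) (x y t1 : G) (m1 : nat)
    (zs : seq G) (x2 y2 : G) : Prop :=
  [/\ subgroup D /\ D = generated ([set x; y] `|` center D),
      cyclic_dprod zs (center D),
      quotient_isomorphic D (center D) C2xC2,
      [~ x, y] = t1 ^+ (2 ^ (m1 - 1))%N
    & x ^+ 2 = x2 /\ y ^+ 2 = y2].

(* In the types with G = D x <t> or G = D x <w>, the product is internal. *)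
Inductive RA_type (G : groupType) (go : G) : Prop :=
| RA_type1 (D : set G) (x y t1 : G) (m1 : nat) of
    has_2power_order t1 m1 &
    D_group D x y t1 m1 [:: t1] 1 1 &
    D = setT & go = 1
| RA_type2 (D : set G) (x y t1 : G) (m1 : nat) of
    has_2power_order t1 m1 &
    D_group D x y t1 m1 [:: t1] t1 t1 &
    D = setT & go = t1
| RA_type3 (D : set G) (x y t1 t2 : G) (m1 m2 : nat) of
    has_2power_order t1 m1 & has_2power_order t2 m2 &
    D_group D x y t1 m1 [:: t1; t2] 1 t2 &
    D = setT & go = 1
| RA_type4 (D : set G) (x y t1 t2 : G) (m1 m2 : nat) of
    has_2power_order t1 m1 & has_2power_order t2 m2 &
    D_group D x y t1 m1 [:: t1; t2] t1 t2 &
    D = setT & go = t1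
| RA_type5 (D : set G) (x y t1 u1 : G) (m1 : nat) of
    has_2power_order t1 m1 & has_infinite_order u1 &
    D_group D x y t1 m1 [:: t1; u1] 1 u1 &
    D = setT & go = 1
| RA_type6 (D : set G) (x y t1 u1 : G) (m1 : nat) of
    has_2power_order t1 m1 & has_infinite_order u1 &
    D_group D x y t1 m1 [:: t1; u1] t1 u1 &
    D = setT & go = t1
| RA_type7 (D : set G) (x y t1 t2 t3 : G) (m1 m2 m3 : nat) of
    has_2power_order t1 m1 & has_2power_order t2 m2 & has_2power_order t3 m3 &
    D_group D x y t1 m1 [:: t1; t2; t3] t2 t3 &
    D = setT & go = 1
| RA_type8 (D : set G) (x y t1 t2 t3 : G) (m1 m2 m3 : nat) of
    has_2power_order t1 m1 & has_2power_order t2 m2 & has_2power_order t3 m3 &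
    D_group D x y t1 m1 [:: t1; t2; t3] t2 t3 &
    D = setT & go = t1
| RA_type9 (D : set G) (x y t1 t2 t3 t : G) (m1 m2 m3 k : nat) of
    has_2power_order t1 m1 & has_2power_order t2 m2 & has_2power_order t3 m3 &
    has_2power_order t k &
    D_group D x y t1 m1 [:: t1; t2; t3] t2 t3 &
    internal_dprod D (cyclic_subgroup t) setT & go = t
| RA_type10 (D : set G) (x y t1 t2 u1 : G) (m1 m2 : nat) of
    has_2power_order t1 m1 & has_2power_order t2 m2 & has_infinite_order u1 &
    D_group D x y t1 m1 [:: t1; t2; u1] t2 u1 &
    D = setT & go = 1
| RA_type11 (D : set G) (x y t1 t2 u1 : G) (m1 m2 : nat) of
    has_2power_order t1 m1 & has_2power_order t2 m2 & has_infinite_order u1 &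
    D_group D x y t1 m1 [:: t1; t2; u1] t2 u1 &
    D = setT & go = t1
| RA_type12 (D : set G) (x y t1 t2 u1 t : G) (m1 m2 k : nat) of
    has_2power_order t1 m1 & has_2power_order t2 m2 & has_infinite_order u1 &
    has_2power_order t k &
    D_group D x y t1 m1 [:: t1; t2; u1] t2 u1 &
    internal_dprod D (cyclic_subgroup t) setT & go = t
| RA_type13 (D : set G) (x y t1 t2 u1 w : G) (m1 m2 : nat) of
    has_2power_order t1 m1 & has_2power_order t2 m2 & has_infinite_order u1 &
    has_infinite_order w &
    D_group D x y t1 m1 [:: t1; t2; u1] t2 u1 &
    internal_dprod D (cyclic_subgroup w) setT & go = w
| RA_type14 (D : set G) (x y t1 u1 u2 : G) (m1 : nat) of
    has_2power_order t1 m1 & has_infinite_order u1 & has_infinite_order u2 &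
    D_group D x y t1 m1 [:: t1; u1; u2] u1 u2 &
    D = setT & go = 1
| RA_type15 (D : set G) (x y t1 u1 u2 : G) (m1 : nat) of
    has_2power_order t1 m1 & has_infinite_order u1 & has_infinite_order u2 &
    D_group D x y t1 m1 [:: t1; u1; u2] u1 u2 &
    D = setT & go = t1
| RA_type16 (D : set G) (x y t1 u1 u2 w : G) (m1 : nat) of
    has_2power_order t1 m1 & has_infinite_order u1 & has_infinite_order u2 &
    has_infinite_order w &
    D_group D x y t1 m1 [:: t1; u1; u2] u1 u2 &
    internal_dprod D (cyclic_subgroup w) setT & go = w.

(* Main.v *)
Require Import Defs.
From mathcomp Require Import ssreflect ssrfun ssrbool monoid.
From HB Require Import structures.
From mathcomp Require Import all_boot all_order all_algebra.
From mathcomp Require Import finmap zify.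
From mathcomp Require Import boolp classical_sets functions cardinality.
From mathcomp.multinomials Require Import monalg.

Set Implicit Arguments.
Unset Strict Implicit.
Unset Printing Implicit Defensive.

Import Order.TTheory GRing.Theory Num.Theory.

Local Open Scope group_scope.

(** The alternative laws of the loop ring, expanded at a sum of two loop
    elements and compared coefficient by coefficient, concern the loop alone:
    if a triple associates, so do all its permutations; if it does not, each of
    the twelve products of its members takes one of two values (as in
    nassociates_rot and nassociates_rev). This yields the middle Moufang
    identity, and with it that squares associate with everything; elements that
    do so are central. Hence the quotient of L by its centre A is an abelian
    group of exponent 2, and commutators and associators take values in A.
    Computing the commutator of a product with a third element, and comparing
    the two ways to bracket it, shows that the associator is additive in each
    argument. Since a nontrivial associator equals the commutator of any two of
    its arguments, all nontrivial associators and commutators are the same s,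
    of order 2, and L/A is a vector space of dimension 3 over the field with
    two elements, with any nonassociating triple x, y, u as a basis
    (RA_structure_exists). The elements generated by x, y and A form a group G,
    and L is M(G, *, u^2) (Mloop_isomorphism).

    For x outside A put l(x) = s x^2, modulo the squares of A. If x and y are
    independent in L/A then (x y)^2 = s x^2 y^2, so l is a linear map from L/A
    to A/2A. A decomposition of A in which one summand contains s and the image
    of l decomposes L (direct_sum_trivial), so L being indecomposable means
    that A has no proper decomposition of this kind. What is left concerns the
    finitely generated abelian group A, the element s and the three rows l(x),
    l(y), l(u) (row_normal_form). The group A is a direct sum of cyclic groups;
    a component of odd order would split off. Among the components that s
    involves, one of least order can be changed so that s lies in it; let t1
    generate it. The rows are then brought to reduced echelon form with respect
    to an order on the components in which those of larger order come first, so
    that replacing the generator at a pivot by the row with this pivot gives a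
    basis again. A component other than that of t1 that contains no pivot would
    split off. So besides t1 there are at most three basis elements, and up to
    a factor s, which can be absorbed, they are the squares of members of the
    triple; each of the remaining members has a square equal to 1 or to t1.
    According to the number of these basis elements, to how many of them are of
    infinite order, and to the last alternative, this is one of the sixteen
    types. *)

(** * The loop ring and its alternative laws *)

Section LoopRing.
Variables (L : umagmaType) (R : comNzRingType).
Local Open Scope ring_scope.
Local Notation mul := (@loop_ring_mul L R).
Implicit Types (a b c : {malg R[L]}) (g h k w : L).

Lemma loop_ring_mulw (d1 d2 : {fset L}) a b :
  (msupp a `<=` d1)%fset -> (msupp b `<=` d2)%fset ->
  mul a b = \sum_(g <- d1) \sum_(h <- d2) << a@_g * b@_h *g (g * h)%g >>.
Proof.
move=> le1 le2; rewrite /loop_ring_mul (big_fset_incl _ le1) /=.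
  apply: eq_bigr => g _; apply: (big_fset_incl _ le2) => h _ /mcoeff_outdom ->.
  by rewrite mulr0 monalgU0.
move=> g _ /mcoeff_outdom ag0; rewrite big1 // => h _.
by rewrite ag0 mul0r monalgU0.
Qed.

Lemma loop_ring_mulDl a b c : mul (a + b) c = mul a c + mul b c.
Proof.
rewrite (loop_ring_mulw (msuppD_le a b) (fsubset_refl _)).
rewrite (loop_ring_mulw (fsubsetUl _ (msupp b)) (fsubset_refl (msupp c))).
rewrite (loop_ring_mulw (fsubsetUr (msupp a) _) (fsubset_refl (msupp c))).
rewrite -big_split; apply: eq_bigr => g _ /=.
rewrite -big_split; apply: eq_bigr => h _ /=.
by rewrite mcoeffD mulrDl monalgUD.
Qed.

Lemma loop_ring_mulDr a b c : mul c (a + b) = mul c a + mul c b.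
Proof.
rewrite (loop_ring_mulw (fsubset_refl _) (msuppD_le a b)).
rewrite (loop_ring_mulw (fsubset_refl (msupp c)) (fsubsetUl _ (msupp b))).
rewrite (loop_ring_mulw (fsubset_refl (msupp c)) (fsubsetUr (msupp a) _)).
rewrite -big_split; apply: eq_bigr => g _ /=.
rewrite -big_split; apply: eq_bigr => h _ /=.
by rewrite mcoeffD mulrDr monalgUD.
Qed.

Lemma loop_ring_mul0l a : mul 0 a = 0.
Proof. by rewrite /loop_ring_mul msupp0 big_seq_fset0. Qed.

Lemma loop_ring_mul0r a : mul a 0 = 0.
Proof.
by rewrite /loop_ring_mul msupp0 big1 // => g _; rewrite big_seq_fset0.
Qed.

Lemma loop_ring_mulUU (r t : R) g h :
  mul << r *g g >> << t *g h >> = << r * t *g (g * h)%g >>.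
Proof.
by rewrite (loop_ring_mulw msuppU_le msuppU_le) !big_seq_fset1 !mcoeffUU.
Qed.

Lemma loop_ring_mulA_of_loop :
  (forall g h k : L, g * h * k = g * (h * k))%g -> associative mul.
Proof.
move=> mulA a b c.
have suml (r : seq L) F x :
    mul (\sum_(g <- r) F g) x = \sum_(g <- r) mul (F g) x.
  exact: (big_morph (mul^~ x) (fun y z => loop_ring_mulDl y z x)
                    (loop_ring_mul0l x)).
have sumr (r : seq L) F x :
    mul x (\sum_(g <- r) F g) = \sum_(g <- r) mul x (F g).
  exact: (big_morph (mul x) (fun y z => loop_ring_mulDr y z x)
                    (loop_ring_mul0r x)).
rewrite (monalgE a) [LHS]suml [X in _ = mul X c]suml [RHS]suml.
apply: eq_bigr => g _; rewrite (monalgE b) [X in mul _ X = _]suml [LHS]sumr.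
rewrite [X in _ = mul X c]sumr [RHS]suml.
apply: eq_bigr => h _;
  rewrite (monalgE c) [X in mul _ X = _]sumr [LHS]sumr [RHS]sumr.
by apply: eq_bigr => k _; rewrite !loop_ring_mulUU mulA mulrA.
Qed.

(** Because 2 is nonzero in R, the numbers 0, 1 and 2 remain distinct there,
    so that sums of two coefficients can be compared as natural numbers. *)
Lemma bool_sum_inj (p q r t : bool) : 2 \notin [pchar R] ->
  p%:R + q%:R = r%:R + t%:R :> R -> (p + q = r + t)%N.
Proof.
rewrite inE /= => two; rewrite -!natrD.
have inj m n : (m <= n <= 2)%N -> m%:R = n%:R :> R -> m = n.
  move=> /andP[lemn len2] eqmn; have /eqP := natrB R lemn.
  rewrite eqmn subrr; have : (n - m <= 2)%N by rewrite (leq_trans _ len2)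
    ?leq_subr.
  case Dk: (n - m)%N => [|[|[|k]]] // _; rewrite ?oner_eq0 ?(negPf two) //.
  by move=> _; apply/eqP; rewrite eqn_leq lemn -subn_eq0 Dk.
have [le|/ltnW le /esym] := leqP (p + q) (r + t).
  by apply: inj; rewrite le; case: r t {le} => [] [].
by move=> /inj ->; rewrite // le; case: p q {le} => [] [].
Qed.

Local Notation U g := (<< 1 *g g >> : {malg R[L]}).

Lemma loop_ring_sum_inj g h g' h' w : 2 \notin [pchar R] ->
  U g + U h = U g' + U h' ->
  ((g == w) + (h == w) = (g' == w) + (h' == w))%N.
Proof.
move=> two /(congr1 (mcoeff w)); rewrite !mcoeffD !mcoeffU.
exact: bool_sum_inj.
Qed.

Lemma left_alternative_linearized g h k :
  (forall x y : {malg R[L]}, mul (mul x x) y = mul x (mul x y)) ->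
  U (g * h * k)%g + U (h * g * k)%g = U (g * (h * k))%g + U (h * (g * k))%g.
Proof.
move=> alt; have := alt (U g + U h) (U k).
have := alt (U h) (U k); have := alt (U g) (U k).
rewrite !(loop_ring_mulDl, loop_ring_mulDr) !loop_ring_mulUU !mulr1 => -> ->.
by rewrite !addrA => /addIr; rewrite -!addrA => /addrI.
Qed.

Lemma right_alternative_linearized g h k :
  (forall x y : {malg R[L]}, mul (mul y x) x = mul y (mul x x)) ->
  U (k * g * h)%g + U (k * h * g)%g = U (k * (g * h))%g + U (k * (h * g))%g.
Proof.
move=> alt; have := alt (U g + U h) (U k).
have := alt (U h) (U k); have := alt (U g) (U k).
rewrite !(loop_ring_mulDl, loop_ring_mulDr) !loop_ring_mulUU !mulr1 => -> ->.
rewrite !addrA => /addIr; rewrite -!addrA => /addrI.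
by rewrite addrC => ->; rewrite addrC.
Qed.

End LoopRing.

(** The four sums of truth values count how often w occurs on either side of
    the linearized alternative laws; after this lemma the coefficient ring
    is forgotten. *)
Lemma RA_loop_linearized (L : umagmaType) : RA_loop L ->
  [/\ is_loop L,
      forall a b c w : L,
        (((a * b * c)%g == w) + ((b * a * c)%g == w) =
         ((a * (b * c))%g == w) + ((b * (a * c))%g == w))%N,
      forall a b c w : L,
        (((c * a * b)%g == w) + ((c * b * a)%g == w) =
         ((c * (a * b))%g == w) + ((c * (b * a))%g == w))%N
    & exists a b c : L, a * b * c <> a * (b * c)].
Proof.
case=> loopL [R [two alt nassoc]]; split=> //.
- move=> a b c w; apply: (loop_ring_sum_inj _ two).
  by apply: left_alternative_linearized => x y; have [] := alt x y.
- move=> a b c w; apply: (loop_ring_sum_inj _ two).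
  by apply: right_alternative_linearized => x y; have [] := alt x y.
apply: contrapT => nex; apply: nassoc; apply: loop_ring_mulA_of_loop => a b c.
by apply: contrapT => ?; apply: nex; exists a, b, c.
Qed.

(** * Associating and nonassociating triples *)

Section AlternativeLoop.
Variable L : umagmaType.
Implicit Types a b c d x y z w n : L.

Definition associates a b c := a * b * c = a * (b * c).

Definition loop_center z :=
  (forall a, z * a = a * z) /\ (forall a b, associates z a b).

Hypothesis RA_L : RA_loop L.

Lemma loop_mulI a b c : a * b = a * c -> b = c.
Proof.
have [[_ [div _]] _ _ _] := RA_loop_linearized RA_L.
by have [d [_ uniq]] := div a (a * c) => eq_ab;
  rewrite -(uniq b eq_ab) (uniq c).
Qed.

Lemma loop_mulIr a b c : b * a = c * a -> b = c.
Proof.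
have [[_ [_ div]] _ _ _] := RA_loop_linearized RA_L.
by have [d [_ uniq]] := div a (c * a) => eq_ab;
  rewrite -(uniq b eq_ab) (uniq c).
Qed.

Lemma loop_div a c : exists b, a * b = c.
Proof.
have [[_ [div _]] _ _ _] := RA_loop_linearized RA_L.
by have [b [eq_ab _]] := div a c; exists b.
Qed.

Let altl a b c w := let: And4 _ alt _ _ := RA_loop_linearized RA_L in alt a b c
  w.
Let altr a b c w := let: And4 _ _ alt _ := RA_loop_linearized RA_L in alt a b c
  w.

Lemma associates_swapl a b c : associates a b c -> associates b a c.
Proof.
rewrite /associates => ab; have := altl a b c (b * a * c).
rewrite ab eqxx; case: (b * (a * c) =P _) => [->//|_]; lia.
Qed.

Lemma associates_swapr a b c : associates a b c -> associates a c b.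
Proof.
rewrite /associates => ab; have := altr b c a (a * c * b).
rewrite ab eqxx; case: (a * (c * b) =P _) => [->//|_]; lia.
Qed.

Lemma associates_rot a b c : associates a b c -> associates b c a.
Proof. by move/associates_swapl/associates_swapr. Qed.

Lemma associates_aab a b : associates a a b.
Proof. by have := altl a a b (a * a * b); rewrite eqxx; case: eqP. Qed.

Lemma associates_abb a b : associates a b b.
Proof. by have := altr b b a (a * b * b); rewrite eqxx; case: eqP. Qed.

Lemma associates_aba a b : associates a b a.
Proof. exact/associates_swapr/associates_aab. Qed.

(** The product on the left has to occur on the right side of the linearized
    left alternative law, and there is only one place left for it. *)
Lemma nassociates_swapl a b c : ~ associates a b c -> a * b * c = b * (a * c).
Proof.
move=> nas; have := altl a b c (a * b * c); rewrite eqxx.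
case: (a * (b * c) =P _) => [/esym//|_].
by case: (b * (a * c) =P _) => [//|_]; lia.
Qed.

Lemma nassociates_swapr a b c : ~ associates a b c -> a * b * c = a * (c * b).
Proof.
move=> nas; have := altr b c a (a * b * c); rewrite eqxx.
case: (a * (b * c) =P _) => [/esym//|_].
by case: (a * (c * b) =P _) => [//|_]; lia.
Qed.

Lemma nassociates_rot a b c : ~ associates a b c -> a * b * c = c * a * b.
Proof.
move=> nas; rewrite (nassociates_swapr nas) (@nassociates_swapl c a b) //.
by move/associates_rot.
Qed.

Lemma nassociates_rev a b c : ~ associates a b c -> a * b * c = c * (b * a).
Proof.
move=> nas; rewrite (nassociates_rot nas) (@nassociates_swapr c a b) //.
by move/associates_rot.
Qed.

(** If a and b commuted, the equality for (b, a, c) given by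
    nassociates_swapl would make a, b, c associate. *)
Lemma nassociates_ncomm a b c : ~ associates a b c -> a * b <> b * a.
Proof.
move=> nas ab; apply: (nas); rewrite /associates ab nassociates_swapl //.
by move/associates_swapl.
Qed.

(** The classical computation in alternative rings: four instances of the
    linearized laws are added up, each read as an equality of multiplicities
    of the right side. *)
Lemma left_Moufang x a y : x * (a * (x * y)) = x * a * x * y.
Proof.
have S1 := altl (x * a) x y (x * (a * (x * y))).
have S2 := altr a (x * y) x (x * (a * (x * y))).
have S3 := altr a y (x * x) (x * (a * (x * y))).
have mulx u v : (x * u == x * v) = (u == v).
  by apply/eqP/eqP => [/loop_mulI|->].
have S4 : let w := x * (a * (x * y)) in
    ((x * (x * a * y) == w)%g + (x * (x * y * a) == w)%g =
     (x * (x * (a * y)) == w)%g + (x * (x * (y * a)) == w)%g)%N.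
  by rewrite /= !mulx; apply: altr.
rewrite -[x * (x * a)]associates_aab -[x * (x * y)]associates_aab in S1 S2.
rewrite ![x * x * (_ * _)]associates_aab in S3.
have: (x * a * x * y == x * (a * (x * y)))%g = true :> nat.
  by move: S1 S2 S3 S4 => /=; rewrite eqxx; lia.
by case: eqP.
Qed.

Lemma middle_Moufang x y z : (x * y) * (z * x) = x * (y * z) * x.
Proof.
have M1 := altr y (z * x) x (x * (y * z * x)).
have mulx u v : (x * u == x * v) = (u == v).
  by apply/eqP/eqP => [/loop_mulI|->].
rewrite -[x * (z * x)]associates_aba -left_Moufang !mulx in M1.
have M2 : let w := y * z * x in
    ((z * x * y == w)%g + (y * (z * x) == w)%g =
     (y * z * x == w)%g + (z * (x * y) == w)%g)%N.
  rewrite /=; have [as_yzx|nas] := pselect (associates y z x).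
    have -> : z * x * y = z * (x * y) by apply: associates_rot.
    by rewrite addnC -as_yzx.
  have -> : z * x * y = y * z * x by apply: nassociates_rot =>
    /associates_rot/associates_rot.
  rewrite -(@nassociates_rev x z y);
    last by move/associates_swapr/associates_rot.
  rewrite -(@nassociates_rev y x z); last by move/associates_swapr.
  by rewrite (@nassociates_rot x z y) // => /associates_swapr/associates_rot.
have : (x * y * (z * x) == x * (y * z * x))%g = true :> nat.
  by move: M2 => /=; rewrite eqxx; lia.
by rewrite associates_aba; case: eqP.
Qed.

(** By the middle Moufang identity both sides of the first associativity are
    the corresponding sides of the second one, multiplied by y. *)
Lemma associates_mull x y z : associates (y * x) z y <-> associates y x z.
Proof.
have mid : y * x * (z * y) = y * (x * z) * y by apply: middle_Moufang.
split=> [as1|as2]; last by rewrite /associates mid as2.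
by apply: loop_mulIr (y) _ _ _; rewrite as1 mid.
Qed.

Lemma associates_mulr x y z : associates y x (z * y) <-> associates x z y.
Proof.
have mid : y * x * (z * y) = y * (x * z * y).
  by rewrite middle_Moufang associates_aba.
split=> [as1|as2]; last by rewrite /associates mid as2.
by apply: loop_mulI (y) _ _ _; rewrite -mid as1.
Qed.

(** The triples (b a, a, c) and (a, a b, c) do not associate either;
    reversing both of them computes c (a b a) in two ways. *)
Lemma nassociates_sqC a b c : ~ associates a b c -> a * a * b = b * (a * a).
Proof.
move=> nas.
have nas1 : ~ associates (b * a) a c.
  move/associates_rot/associates_mulr/associates_swapl.
  by move/associates_rot/associates_rot.
have nas2 : ~ associates a (a * b) c.
  by move/associates_swapl/associates_swapr/associates_mull.
have E1 := nassociates_rev nas1; have E2 := nassociates_rev nas2.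
rewrite associates_abb in E1; rewrite -associates_aab in E2.
by apply: loop_mulIr (c) _ _ _; rewrite E1 E2 associates_aba.
Qed.

(** If a, x, y associate, then a, a x, y associate too, and a^2 can be moved
    in two steps. Otherwise a^2 commutes with x, which does not happen in a
    nonassociating triple. *)
Lemma sq_nucleus a x y : associates (a * a) x y.
Proof.
have [as1|nas] := pselect (associates a x y); last first.
  apply: contrapT => /nassociates_ncomm; apply; exact: nassociates_sqC nas.
have as2 : associates a (a * x) y.
  by apply/associates_swapl/associates_swapr/associates_mull.
by rewrite /associates !associates_aab -as1 -as2.
Qed.

(** Multiplying a by n keeps the triple nonassociating, and
    nassociates_swapl for the new triple moves n past b. *)
Lemma nucleus_comm_nas n a b c : (forall x y, associates n x y) ->
  ~ associates a b c -> n * b = b * n.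
Proof.
move=> nuc nas; have nas' : ~ associates (n * a) b c.
  rewrite /associates !nuc => /loop_mulI; exact: nas.
have bnc x : associates b n x by apply: associates_swapl.
have := nassociates_swapl nas'.
rewrite !nuc (nassociates_swapl nas) -nuc -[b * (n * _)]bnc.
exact: loop_mulIr.
Qed.

(** If b lies in the nucleus too, then n commutes with a0 and with b a0 for
    a member a0 of a nonassociating triple, hence with b. *)
Lemma nucleus_center n : (forall x y, associates n x y) -> loop_center n.
Proof.
move=> nuc; split=> // b.
have [_ _ _ [a0 [b0 [c0 nas0]]]] := RA_loop_linearized RA_L.
have [[x [y nas]]|bnuc] := pselect (exists x y, ~ associates b x y).
  by apply: (@nucleus_comm_nas n x b y) => // /associates_swapl.
have {}bnuc x y : associates b x y.
  by apply: contrapT => nas; apply: bnuc; exists x, y.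
have nas1 : ~ associates (b * a0) b0 c0.
  by rewrite /associates !bnuc => /loop_mulI; apply: nas0.
have a0n : n * a0 = a0 * n.
  by apply: (@nucleus_comm_nas n b0 a0 c0) => // /associates_swapl.
have ba0n : n * (b * a0) = b * a0 * n.
  by apply: (@nucleus_comm_nas n b0 (b * a0) c0) => // /associates_swapl.
by apply: loop_mulIr (a0) _ _ _; rewrite nuc ba0n bnuc -a0n bnuc.
Qed.

Lemma sq_center a : loop_center (a * a).
Proof. exact/nucleus_center/sq_nucleus. Qed.

Lemma center1 : loop_center 1.
Proof. by split=> [a|a b]; rewrite /associates ?mulg1 !mul1g. Qed.

Lemma centerM z w : loop_center z -> loop_center w -> loop_center (z * w).
Proof.
move=> [zC zA] [wC wA]; split=> [a|a b].
  rewrite zA wC -[z * _]zA zC.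
  have az x : associates a z x by apply: associates_swapl.
  by rewrite az.
by rewrite /associates zA zA wA -zA.
Qed.

Lemma centerV z : loop_center z -> exists2 w, loop_center w & z * w = 1.
Proof.
move=> [zC zA]; have [w zw] := loop_div z 1; exists w => //; split=> [a|a b].
  apply: loop_mulI (z) _ _ _; rewrite -!zA zw mul1g zC.
  have az x : associates a z x by apply: associates_swapl.
  by rewrite az zw mulg1.
by apply: loop_mulI (z) _ _ _; rewrite -!zA zw !mul1g.
Qed.

(** The centre is handled as an additive group A, of which i is the
    inclusion in L: the structure of A is the subject of the second half of
    the proof. *)
Definition center_embedding (A : zmodType) (i : A -> L) :=
  [/\ injective i, i 0%R = 1, forall p q, i (p + q)%R = i p * i q
    & forall x, loop_center x <-> exists p, i p = x].

Lemma center_embedding_exists :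
  exists (A : zmodType) (i : A -> L), center_embedding i.
Proof.
pose C := {z : L | `[< loop_center z >]}.
have inC z : loop_center z -> `[< loop_center z >] by move/asboolP.
have CP (z : C) : loop_center (sval z) by case: z => z /= /asboolP.
have ext (z w : C) : sval z = sval w -> z = w by move=> eq_zw; apply: val_inj.
pose zero : C := exist _ 1 (inC _ center1).
pose add (z w : C) : C := exist _ (sval z * sval w) (inC _ (centerM (CP z) (CP
  w))).
have [opp oppK] : {opp : C -> C & forall z : C, sval z * sval (opp z) = 1}.
  apply: (@choice _ _ (fun z w : C => sval z * sval w = 1)) => z.
  by have [w wC zw] := centerV (CP z); exists (exist _ w (inC _ wC)).
have addA : associative add.
  by move=> z w t; apply: ext => /=; have [_ ->] := CP z.
have addC : commutative add.
  by move=> z w; apply: ext => /=; have [-> _] := CP z.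
have add0 : left_id zero add by move=> z; apply: ext; rewrite /= mul1g.
have addN : left_inverse zero opp add.
  by move=> z; rewrite addC; apply: ext; rewrite /= oppK.
pose A : zmodType := HB.pack C (GRing.isZmodule.Build C addA addC add0 addN).
exists A, (fun z : C => sval z); split=> //.
move=> x; split=> [/inC xC|[z <-]]; last exact: CP.
by exists (exist _ x xC).
Qed.

(** Both (b a) (a b) = a^2 b^2 and (a b) (a b) are squares or products of
    squares, hence central. *)
Lemma commutator_central (A : zmodType) (i : A -> L) a b :
  center_embedding i -> exists k, a * b = i k * (b * a).
Proof.
move=> [iinj i0 iD iP].
have /iP[p Dp] : loop_center (a * a * (b * b)) by apply: centerM;
  apply: sq_center.
have /iP[q Dq] := sq_center (a * b).
have /iP[_ iA] : exists t, i t = i (q - p)%R by exists (q - p)%R.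
exists (q - p)%R; apply: loop_mulIr (a * b) _ _ _.
rewrite -Dq iA.
have -> : b * a * (a * b) = i p.
  rewrite Dp [LHS](_ : _ = b * (a * (a * b))); last first.
    by apply/associates_mulr/associates_aab.
  have [sqC sqA] := sq_center a.
  by rewrite -associates_aab sqC -[LHS]associates_aab -sqC.
by rewrite -iD subrK.
Qed.
End AlternativeLoop.

(** * Commutators and associators *)

Definition noncomm (L : umagmaType) (a b : L) := a * b != b * a.
Definition nonassoc (L : umagmaType) (a b c : L) := a * b * c != a * (b * c).
Definition power_bit (L : umagmaType) (a : L) (e : bool) := if e then a else 1.

(** The structure of an RA loop. Commutators and associators are powers of
    s, recorded by the truth values noncomm and nonassoc of their
    nontriviality. Modulo the centre nonassoc is the nonzero alternating
    trilinear form of a space of dimension 3 over the field with two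
    elements. *)
Record RA_structure (L : umagmaType) (A : zmodType) (i : A -> L) (s : A) : Prop
  := {
  RA_emb : center_embedding i;
  RA_s_neq0 : s <> 0%R;
  RA_s2 : (s + s)%R = 0%R;
  RA_mulC : forall a b : L, a * b = i (s *+ noncomm a b)%R * (b * a);
  RA_mulA : forall a b c : L,
    a * b * c = i (s *+ nonassoc a b c)%R * (a * (b * c));
  RA_noncommM : forall a b c : L, noncomm (a * b) c =
    noncomm a c (+) noncomm b c (+) nonassoc a b c;
  RA_nonassocM : forall a b c d : L,
    nonassoc a b (c * d) = nonassoc a b c (+) nonassoc a b d;
  RA_nonassoc_swap : forall a b c : L, nonassoc a b c = nonassoc b a c;
  RA_nonassoc_rot : forall a b c : L, nonassoc a b c = nonassoc b c a;
  RA_nonassoc_noncomm : forall a b c : L, nonassoc a b c -> noncomm a b;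
  RA_coordinates : forall x y u g : L, nonassoc x y u -> exists z e1 e2 e3,
    g = i z * (power_bit x e1 * power_bit y e2 * power_bit u e3);
  RA_triple : exists x y u : L, nonassoc x y u;
  RA_square : forall a : L, exists p, a * a = i p
}.

Section Invariants.
Variables (L : umagmaType) (A : zmodType) (i : A -> L).
Hypothesis RA_L : RA_loop L.
Hypothesis emb : center_embedding i.
Implicit Types (a b c d g h x y u : L) (p q r s z : A).

Lemma center_mem p : loop_center (i p).
Proof. by have [_ _ _ iP] := emb; apply/iP; exists p. Qed.

Lemma centerC p a : i p * a = a * i p.
Proof. by have [-> _] := center_mem p. Qed.

Lemma center_mulA p a b : i p * a * b = i p * (a * b).
Proof. by have [_ ->] := center_mem p. Qed.

Lemma center_mulCA p a b : a * (i p * b) = i p * (a * b).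
Proof.
have [_ iA] := center_mem p.
have <- : a * i p * b = a * (i p * b) by apply/associates_swapl.
by rewrite -centerC center_mulA.
Qed.

Lemma center_mulD p q a : i p * (i q * a) = i (p + q)%R * a.
Proof. by have [_ _ iD _] := emb; rewrite iD center_mulA. Qed.

Lemma center_mul0 a : i 0%R * a = a.
Proof. by have [_ -> _ _] := emb; rewrite mul1g. Qed.

Lemma center_cancel p q a : i p * a = i q * a -> p = q.
Proof. by have [iinj _ _ _] := emb => /(loop_mulIr RA_L)/iinj. Qed.

Section AdditiveInvariants.
Variable kap : L -> L -> A.
Hypothesis kapE : forall a b, a * b = i (kap a b) * (b * a).
Local Open Scope ring_scope.

Let alp a b c := if `[< associates a b c >] then 0 else kap a b.

Let alp_as a b c : associates a b c -> alp a b c = 0.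
Proof. by move=> ?; rewrite /alp asboolT. Qed.

Let alp_nas a b c : ~ associates a b c -> alp a b c = kap a b.
Proof. by move=> ?; rewrite /alp asboolF. Qed.

Let alpE a b c : (a * b * c = i (alp a b c) * (a * (b * c)))%g.
Proof.
have [as1|nas] := pselect (associates a b c).
  by rewrite alp_as // center_mul0 as1.
rewrite alp_nas // [in LHS](kapE a b) center_mulA (@nassociates_swapl _ RA_L b
  a) //.
by move/(associates_swapl RA_L).
Qed.

Let kap_opp a b : kap a b + kap b a = 0.
Proof.
apply: (@center_cancel _ _ (a * b)%g).
by rewrite -center_mulD -kapE -kapE center_mul0.
Qed.

(** Move a past b in a (a b), one factor at a time; a^2 is central. *)
Let kap2 a b : kap a b + kap a b = 0.
Proof.
apply: (@center_cancel _ _ (a * a * b)%g); rewrite center_mul0.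
have [aaC _] := sq_center RA_L a.
rewrite {1}aaC -(associates_abb RA_L) -center_mulD -(center_mulA _ (b * a)%g).
by rewrite -kapE (associates_aba RA_L) -center_mulCA -kapE (associates_aab
  RA_L).
Qed.

Let kapC a b : kap a b = kap b a.
Proof. by apply: (addIr (kap b a)); rewrite kap_opp kap2. Qed.

Let alp2 a b c : alp a b c + alp a b c = 0.
Proof. by rewrite /alp; case: ifP; rewrite ?addr0. Qed.

Let alp_swapl a b c : alp a b c = alp b a c.
Proof.
have [as1|nas] := pselect (associates a b c).
  by rewrite !alp_as //; apply/associates_swapl.
by rewrite !alp_nas 1?kapC // => /(associates_swapl RA_L).
Qed.

Let alp_rot a b c : alp a b c = alp b c a.
Proof.
have [as1|nas] := pselect (associates a b c).
  by rewrite !alp_as //; apply/associates_rot.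
have nas1 : ~ associates b c a.
  by move/(associates_rot RA_L)/(associates_rot RA_L).
have nas2 : ~ associates a c b by move/(associates_swapr RA_L).
have nas3 : ~ associates c b a by move/(associates_swapl RA_L).
apply: (@center_cancel _ _ (a * (b * c))%g); rewrite -alpE.
rewrite (_ : a * (b * c) = b * (c * a))%g -?alpE; last first.
  rewrite -(nassociates_rev RA_L nas3) -(nassociates_rev RA_L nas2).
  exact: nassociates_rot.
by rewrite (nassociates_rot RA_L nas1).
Qed.

Let alp_swapr a b c : alp a b c = alp a c b.
Proof. by rewrite alp_rot alp_swapl alp_rot alp_rot. Qed.

Let kapM a b c : kap (a * b)%g c = kap a c + kap b c + alp a b c.
Proof.
apply: (@center_cancel _ _ (c * (a * b))%g); rewrite -kapE alpE (kapE b c).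
rewrite center_mulCA center_mulD.
have -> : (a * (c * b) = i (alp a c b) * (a * c * b))%g.
  by rewrite alpE center_mulD alp2 center_mul0.
rewrite (kapE a c) center_mulA alpE !center_mulD.
rewrite -(alp_swapr a b c) (_ : alp c a b = alp a b c); last by rewrite alp_rot.
congr (i _ * _)%g.
by rewrite (addrAC (alp a b c)) alp2 add0r (addrC (kap b c)).
Qed.

Let kap_i p a : kap (i p) a = 0.
Proof. by apply: (@center_cancel _ _ (a * i p)%g);
  rewrite -kapE centerC center_mul0. Qed.

Let kap_mul_i p a b : kap (i p * a)%g b = kap a b.
Proof.
apply: (@center_cancel _ _ (b * (i p * a))%g); rewrite -kapE center_mulA.
by rewrite (kapE a b) (center_mulCA p) !center_mulD addrC.
Qed.

(** The commutator of a product of three elements does not depend on how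
    they are bracketed. Together with the pentagon of rebracketings of a b c
    d this gives additivity. *)
Let alpM a b c d : alp a b (c * d)%g = alp a b c + alp a b d.
Proof.
have pent : alp (a * b)%g c d + alp a b (c * d)%g
            = alp a b c + (alp a (b * c)%g d + alp b c d).
  apply: (@center_cancel _ _ (a * (b * (c * d)))%g).
  rewrite -[LHS]center_mulD -alpE -alpE (alpE a b c) center_mulA.
  rewrite (alpE a (b * c)%g) (alpE b) (center_mulCA (alp b c d)).
  by rewrite !center_mulD !addrA.
have sym : kap (a * b * c)%g d = kap (a * (b * c))%g d by rewrite alpE
  kap_mul_i.
move: sym; rewrite !kapM -!addrA => /addrI/addrI.
rewrite addrCA => /addrI sym.
move: pent; rewrite (addrC (alp a (b * c)%g d)) -sym addrA [in RHS]addrC =>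
  /addrI ->.
by [].
Qed.

Let alp_kap a b c : alp a b c = 0 \/ alp a b c = kap a b.
Proof.
by have [/alp_as|/alp_nas] := pselect (associates a b c); [left | right].
Qed.

Let alp_aab a b : alp a a b = 0.
Proof. exact/alp_as/associates_aab. Qed.

Let alp_i p a b : alp (i p) a b = 0.
Proof. by apply: alp_as; have [_] := center_mem p. Qed.

Section Triple.
Variables (x y u : L).
Hypothesis nas : ~ associates x y u.
Let s := kap x y.

Let axyu : alp x y u = s.
Proof. exact: alp_nas. Qed.

Let s_neq0 : s <> 0.
Proof.
move=> s0; apply: nas; have := alpE x y u.
by rewrite axyu s0 center_mul0.
Qed.

Let ayux : alp y u x = s. Proof. by rewrite -alp_rot. Qed.
Let auxy : alp u x y = s. Proof. by rewrite alp_rot. Qed.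

Let kyu : kap y u = s.
Proof. by case: (alp_kap y u x); rewrite ayux. Qed.

Let kux : kap u x = s.
Proof. by case: (alp_kap u x y); rewrite auxy. Qed.

(** Such a d commutes with x, y and u, because d u and u have the same
    associator with x and y, and so on. If d had a nontrivial associator
    with p and q, one could add u to p to make x, y, p nonassociating; then
    the commutator of d x with p would be both s and s times that of d with
    p. *)
Let alp_ker d : alp y u d = 0 -> alp u x d = 0 -> alp x y d = 0 ->
  loop_center d.
Proof.
move=> yud uxd xyd; apply: (nucleus_center RA_L) => p q.
have comm_d a b c : alp a b c = s -> kap a b = s -> kap a c = s ->
    alp a b d = 0 -> alp a c d = 0 -> kap d a = 0.
  move=> abc kab kac abd acd.
  have ac_d : kap (c * d)%g a = s.
    have := alp_kap a (c * d)%g b.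
    rewrite alp_swapr alpM abc abd addr0 kapC => -[/s_neq0//|->//].
  move: ac_d; rewrite kapM (kapC c) kac -(alp_rot a c) acd addr0.
  by rewrite -[RHS]addr0 => /addrI.
have s2 : s + s = 0 by apply: kap2.
have dx : kap d x = 0.
  by apply: (comm_d x y u) => //; rewrite 1?kapC // alp_swapl.
have dy : kap d y = 0.
  by apply: (comm_d y u x) => //; rewrite 1?kapC // alp_swapl.
have du : kap d u = 0.
  by apply: (comm_d u x y) => //; rewrite 1?kapC // alp_swapl.
have dnull a b : kap d a = 0 -> alp d a b = 0.
  by move=> da; case: (alp_kap d a b) => ->.
apply: contrapT => nasd; have r_neq0 : kap d p <> 0.
  by move=> r0; apply: nasd; have := alpE d p q; rewrite dnull // center_mul0.
wlog xyp : p nasd r_neq0 / alp x y p = s.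
  move=> IH; have [xyp|xyp] := alp_kap x y p; last exact: (IH p).
  have Dp' : alp d (p * u)%g q = kap d p.
    by rewrite alp_swapr alpM (alp_swapr d q u) (dnull u q) // addr0 alp_swapr
      alp_nas.
  have Dr' : kap d (p * u)%g = kap d p.
    by case: (alp_kap d (p * u)%g q); rewrite Dp' // => /esym.
  apply: (IH (p * u)%g); rewrite ?Dr' //; first by move/alp_as; rewrite Dp'.
  by rewrite alpM xyp add0r.
have xp : kap x p = s.
  by have := alp_kap x p y; rewrite alp_swapr xyp => -[/s_neq0//|->].
have dxp : kap (d * x)%g p = s.
  have := alp_kap (d * x)%g p y.
  rewrite alp_rot alpM -(alp_rot d) (alp_swapr d).
  by rewrite (dnull y) // add0r -(alp_rot x) alp_swapr xyp => -[/s_neq0//|->].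
move: dxp; rewrite kapM xp (dnull x) // addr0 -[X in _ = X]add0r => /addIr.
exact: r_neq0.
Qed.
Let alp_bit (f : L -> A) a e : f a = s -> f 1%g = 0 ->
  f (power_bit a e) = s *+ e.
Proof. by case: e. Qed.

Let alp_1 a b : alp a b 1%g = 0.
Proof. by apply: alp_as; rewrite /associates !mulg1. Qed.

Let bit_sq a e : exists q, (power_bit a e * power_bit a e)%g = i q.
Proof.
have [_ _ _ iP] := emb.
by have /iP[q <-] := sq_center RA_L (power_bit a e); exists q.
Qed.

(** Multiply once more by the power of a, whose square is central. *)
Let unmul h a b e p : (h * power_bit a e = i p * b)%g ->
  exists q, (h = i q * (b * power_bit a e))%g.
Proof.
have [q Dq] := bit_sq a e => /(congr1 (fun t => t * power_bit a e)%g).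
rewrite (associates_abb RA_L) Dq -centerC center_mulA => Eh.
by exists (- q + p); rewrite -center_mulD -Eh center_mulD addNr center_mul0.
Qed.

Lemma loop_coordinates g : exists z e1 e2 e3,
  (g = i z * (power_bit x e1 * power_bit y e2 * power_bit u e3))%g.
Proof.
have form f : f = alp y u \/ f = alp u x \/ f = alp x y -> f 1%g = 0 /\
    (forall a b, f (a * b)%g = f a + f b) /\ exists e : bool, f g = s *+ e.
  have s01 v : v = 0 \/ v = s -> exists e : bool, v = s *+ e.
    by case=> ->; [exists false | exists true].
  move=> Df; split; first by case: Df => [->|[->|->]]; apply: alp_1.
  split; first by case: Df => [->|[->|->]] a b; apply: alpM.
  apply: s01; case: Df => [->|[->|->]].
  - by have := alp_kap y u g; rewrite kyu.
  - by have := alp_kap u x g; rewrite kux.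
  - exact: alp_kap.
have [yu1 [yuM [e1 yug]]] := form (alp y u) (or_introl erefl).
have [ux1 [uxM [e2 uxg]]] := form (alp u x) (or_intror (or_introl erefl)).
have [xy1 [xyM [e3 xyg]]] := form (alp x y) (or_intror (or_intror erefl)).
have bit0 f a e : f a = 0 -> f 1%g = 0 -> f (power_bit a e) = 0 :> A by case: e.
have alp_bit2 (e : bool) : s *+ e + s *+ e = 0 by case: e;
  [exact: kap2 | exact: addr0].
have alp_aba a b : alp a b a = 0 by rewrite -alp_rot alp_aab.
have alp_abb a b : alp a b b = 0 by rewrite alp_rot alp_aab.
have: loop_center (g * power_bit u e3 * power_bit y e2 * power_bit x e1)%g.
  apply: alp_ker; rewrite ?yuM ?uxM ?xyM.
  - rewrite yug (bit0 (alp y u) u) // (bit0 (alp y u) y) // !addr0.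
    by rewrite (@alp_bit (alp y u)).
  - rewrite uxg (bit0 (alp u x) u) // (bit0 (alp u x) x) // !addr0.
    by rewrite (@alp_bit (alp u x)).
  - rewrite xyg (bit0 (alp x y) y) // (bit0 (alp x y) x) // !addr0.
    by rewrite (@alp_bit (alp x y)).
have [_ _ _ iP] := emb => /iP[z /esym]; rewrite -[i z]mulg1.
move=> /unmul[z1]; rewrite mul1g => /unmul[z2] /unmul[z3] Dg.
by exists z3, e1, e2, e3.
Qed.

Let span_ind (P : L -> Prop) : P x -> P y -> P u -> (forall p, P (i p)) ->
  (forall a b, P a -> P b -> P (a * b)%g) -> forall g, P g.
Proof.
move=> Px Py Pu Pi PM g; have [z [e1 [e2 [e3 ->]]]] := loop_coordinates g.
have P1 : P 1%g by have [_ <- _ _] := emb.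
by apply: (PM) => //; apply: (PM); [apply: (PM) |];
   [case: e1 | case: e2 | case: e3].
Qed.

Let in01 (v : A) := v = 0 \/ v = s.

Let in01D v w : in01 v -> in01 w -> in01 (v + w).
Proof.
by case=> -> [] ->; rewrite ?addr0 ?add0r; [left|right|right|left; apply: kap2].
Qed.

(** By additivity it suffices to expand the first two arguments in x, y, u.
    A nontrivial associator of two of these with a third element equals
    their commutator s. *)
Lemma alp_val g h k : in01 (alp g h k).
Proof.
have in01_0 : in01 0 by left.
have base a b : in01 (kap a b) -> forall c, in01 (alp a b c).
  by move=> kab c; case: (alp_kap a b c) => ->.
have expand a b : (forall c, in01 (alp a x c)) -> (forall c, in01 (alp a y c))
  ->
    (forall c, in01 (alp a u c)) -> in01 (alp a b k).
  move=> ax ay au; move: b; apply: span_ind => // [p|b c ab ac].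
    by rewrite alp_swapl alp_i.
  by rewrite alp_swapr alpM; apply: in01D; rewrite alp_swapr.
have kin a b : kap a b = s -> forall c, in01 (alp a b c).
  by move=> kab; apply: base; right.
have kin' a b : kap a b = s -> forall c, in01 (alp b a c).
  by move=> kab; apply: base; right; rewrite kapC.
have kaa a c : in01 (alp a a c) by rewrite alp_aab.
move: g; apply: span_ind => [||||a b].
- by apply: expand; [apply: kaa | apply: kin | apply: kin'].
- by apply: expand; [apply: kin' | apply: kaa | apply: kin].
- by apply: expand; [apply: kin | apply: kin' | apply: kaa].
- by move=> p; rewrite alp_i.
by move=> ah bh; rewrite alp_rot alpM; apply: in01D; rewrite -alp_rot.
Qed.

Lemma kap_val g h : in01 (kap g h).
Proof.
have in01_0 : in01 0 by left.
have expand a : in01 (kap x a) -> in01 (kap y a) -> in01 (kap u a) ->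
    forall b, in01 (kap b a).
  move=> xa ya ua; apply: span_ind => // [p|b c ab ac]; first by rewrite kap_i.
  by rewrite kapM; apply: in01D; [apply: in01D | apply: alp_val].
have kaa a : kap a a = 0.
  by apply: (@center_cancel _ _ (a * a)%g); rewrite -kapE center_mul0.
by apply: (expand); rewrite kapC; apply: (expand); rewrite ?kaa //; right;
  rewrite // kapC.
Qed.
End Triple.

Lemma RA_structure_of_kap : exists s, RA_structure i s.
Proof.
have [_ _ _ [x [y [u nas]]]] := RA_loop_linearized RA_L.
set s := kap x y.
have s_neq0 : s <> 0.
  move=> s0; apply: (nassociates_ncomm RA_L nas).
  by rewrite kapE -/s s0 center_mul0.
have kapb a b : kap a b = s *+ noncomm a b.
  have [s0|Ds] := kap_val nas a b; rewrite /noncomm kapE ?s0 ?Ds.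
    by rewrite center_mul0 eqxx.
  case: eqP => //; rewrite -[X in _ = X]center_mul0.
  by move/center_cancel/s_neq0.
have alpb a b c : alp a b c = s *+ nonassoc a b c.
  have [s0|Ds] := alp_val nas a b c; rewrite /nonassoc alpE ?s0 ?Ds.
    by rewrite center_mul0 eqxx.
  case: eqP => //; rewrite -[X in _ = X]center_mul0.
  by move/center_cancel/s_neq0.
have sD (e f : bool) : s *+ e + s *+ f = s *+ (e (+) f).
  by case: e f => [] []; rewrite ?addr0 ?add0r //; apply: kap2.
have s_inj (e f : bool) : s *+ e = s *+ f -> e = f.
  by case: e f => [] [] // /esym; rewrite ?mulr1n ?mulr0n // => /esym.
exists s; split=> // [|a b|a b c|a b c|a b c d|a b c|a b c|a b c|x' y' u' g||a].
- exact: kap2.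
- by rewrite kapE kapb.
- by rewrite alpE alpb.
- by apply: s_inj; rewrite -!sD -!kapb -alpb kapM.
- by apply: s_inj; rewrite -!sD -!alpb alpM.
- by apply: s_inj; rewrite -!alpb alp_swapl.
- by apply: s_inj; rewrite -!alpb alp_rot.
- by move/eqP/(nassociates_ncomm RA_L)/eqP.
- by move/eqP => nas'; apply: loop_coordinates.
- by exists x, y, u; apply/eqP.
by have [_ _ _ iP] := emb; have /iP[p <-] := sq_center RA_L a; exists p.
Qed.

End AdditiveInvariants.
End Invariants.

Theorem RA_structure_exists (L : umagmaType) : RA_loop L ->
  exists (A : zmodType) (i : A -> L) (s : A), RA_structure i s.
Proof.
move=> RA_L; have [A [i emb]] := center_embedding_exists RA_L.
exists A, i; have [kap kapE] : {kap : L * L -> A &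
    forall ab, ab.1 * ab.2 = i (kap ab) * (ab.2 * ab.1)}.
  apply: (@choice _ _ (fun ab p => ab.1 * ab.2 = i p * (ab.2 * ab.1))) => -[a
    b].
  exact: commutator_central.
apply: (RA_structure_of_kap RA_L emb (kap := fun a b => kap (a, b))).
by move=> a b; apply: (kapE (a, b)).
Qed.

(** * Bases of finitely generated abelian groups *)

Section Bases.
Variable A : zmodType.
Local Open Scope ring_scope.
Implicit Types (a v w : A).

Definition comb r (e : 'I_r -> A) (c : 'I_r -> int) := \sum_j e j *~ c j.

(** The divisibility o j %| c j covers both kinds of order: o j = 0 stands
    for infinite order, as only 0 is divisible by 0. *)
Definition basis r (e : 'I_r -> A) (o : 'I_r -> nat) :=
  (forall a, exists c, a = comb e c) /\
  (forall c, comb e c = 0 <-> forall j, ((o j)%:Z %| c j)%Z).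

Definition update r (e : 'I_r -> A) i a := fun j => if j == i then a else e j.

Lemma eq_comb r (e : 'I_r -> A) c d : c =1 d -> comb e c = comb e d.
Proof. by move=> eq_cd; apply: eq_bigr => j _; rewrite eq_cd. Qed.

Lemma combD r (e : 'I_r -> A) c d :
  comb e c + comb e d = comb e (fun j => c j + d j).
Proof. by rewrite -big_split; apply: eq_bigr => j _; rewrite mulrzDr. Qed.

Lemma combN r (e : 'I_r -> A) c : - comb e c = comb e (fun j => - c j).
Proof. by rewrite -sumrN; apply: eq_bigr => j _; rewrite mulrNz. Qed.

Lemma combB r (e : 'I_r -> A) c d :
  comb e c - comb e d = comb e (fun j => c j - d j).
Proof. by rewrite combN combD. Qed.

Lemma combMz r (e : 'I_r -> A) c n : comb e c *~ n = comb e (fun j => c j * n).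
Proof. by rewrite mulrz_suml; apply: eq_bigr => j _; rewrite mulrzA. Qed.

Lemma comb0 r (e : 'I_r -> A) : comb e (fun=> 0) = 0.
Proof. by rewrite /comb big1 // => j _; rewrite mulr0z. Qed.

Lemma comb_single r (e : 'I_r -> A) i n :
  comb e (fun j => if j == i then n else 0) = e i *~ n.
Proof.
rewrite /comb (bigD1 i) //= eqxx big1 ?addr0 // => j /negPf ->.
by rewrite mulr0z.
Qed.

Lemma comb_update r (e : 'I_r -> A) i c d :
  comb (update e i (comb e c)) d
    = comb e (fun j => (if j == i then 0 else d j) + d i * c j).
Proof.
rewrite -combD {1}/comb (bigD1 i) //= /update eqxx addrC; congr (_ + _).
  rewrite [RHS](bigD1 i) //= eqxx mulr0z add0r.
  by apply: eq_bigr => j /negPf ->.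
by rewrite combMz; apply: eq_comb => j; rewrite mulrC.
Qed.

(** Replacing one element by a combination in which it has coefficient 1 is
    unitriangular; the condition says that the order of the old element
    annihilates the new one. *)
Lemma basis_update r (e : 'I_r -> A) o i c : basis e o -> c i = 1 ->
  (forall j, ((o j)%:Z %| (o i)%:Z * c j)%Z) ->
  basis (update e i (comb e c)) o.
Proof.
move=> [gen rel] ci1 oc; split=> [a|d].
  have [d ->] := gen a; exists (fun j => if j == i then d i else d j - d i * c
    j).
  rewrite comb_update; apply: eq_comb => j; rewrite eqxx.
  by case: eqP => [->|_]; rewrite ?ci1 ?mulr1 ?add0r ?subrK.
rewrite comb_update rel; split=> od.
  have odi : ((o i)%:Z %| d i)%Z by have := od i; rewrite eqxx add0r ci1 mulr1.
  move=> j; have := od j; case: eqP => [-> //|_] odj.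
  have odc : ((o j)%:Z %| d i * c j)%Z.
    by apply: dvdz_trans (oc j) _; apply: dvdz_mul.
  by rewrite rpredDr in odj.
move=> j; apply: rpredD; first by case: eqP => // _; apply: dvdz0.
by apply: dvdz_trans (oc j) _; apply: dvdz_mul.
Qed.

Definition same_span m n (g : 'I_m -> A) (e : 'I_n -> A) :=
  forall a, (exists c, a = comb g c) <-> (exists c, a = comb e c).

Lemma same_span_update r (e : 'I_r -> A) i c : c i = 1 ->
  same_span e (update e i (comb e c)).
Proof.
move=> ci1 a; split=> [] [d ->]; last by rewrite comb_update; eexists.
exists (fun j => if j == i then d i else d j - d i * c j).
rewrite comb_update; apply: eq_comb => j; rewrite eqxx.
by case: eqP => [->|_]; rewrite ?ci1 ?mulr1 ?add0r ?subrK.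
Qed.

Lemma comb_lift r (e : 'I_r.+1 -> A) i c :
  comb e c = e i *~ c i + comb (fun j => e (lift i j)) (fun j => c (lift i j)).
Proof. exact: (bigD1_ord i). Qed.

Definition ord_cons T r (a : T) (e : 'I_r -> T) : 'I_r.+1 -> T :=
  fun j => if unlift ord0 j is Some j' then e j' else a.

Lemma ord_cons0 T r (a : T) (e : 'I_r -> T) : ord_cons a e ord0 = a.
Proof. by rewrite /ord_cons unlift_none. Qed.

Lemma ord_consS T r (a : T) (e : 'I_r -> T) j :
  ord_cons a e (lift ord0 j) = e j.
Proof. by rewrite /ord_cons liftK. Qed.

Lemma comb_cons r a (e : 'I_r -> A) c : comb (ord_cons a e) c =
  a *~ c ord0 + comb e (fun j => c (lift ord0 j)).
Proof.
rewrite (comb_lift _ ord0) ord_cons0; congr (_ + _).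
by apply: eq_bigr => j _; rewrite ord_consS.
Qed.

(** Take a coefficient k as small as possible among all nontrivial relations
    of all families with the span of g. Dividing the other coefficients of
    the relation by k and changing the generator with coefficient k
    accordingly, all remainders vanish by minimality, so k kills this
    generator; and k divides its coefficient in any other relation. *)
Lemma minimal_relation n (g : 'I_n -> A) :
  (exists2 c, comb g c = 0 & exists j, c j != 0) ->
  exists (h : 'I_n -> A) j (k : nat), [/\ same_span g h, (0 < k)%N, h j *~ k = 0
    & forall c, comb h c = 0 -> (k%:Z %| c j)%Z].
Proof.
move=> [c0 g_c0 [j0 c0j0]].
pose Q k := (0 < k)%N /\
  exists (h : 'I_n -> A) c j, [/\ same_span g h, comb h c = 0 & `|c j|%N = k].
have exQ : exists k, `[< Q k >].
  exists `|c0 j0|%N; apply/asboolP; split; first by rewrite absz_gt0.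
  by exists g, c0, j0; split.
case: (ex_minnP exQ) => k /asboolP[k_gt0 [g' [c [j [gg' g'c cjk]]]]] kmin.
have K0 : c j != 0 by rewrite -absz_gt0 cjk.
pose q i := if i == j then 1 else (c i %/ c j)%Z.
pose h := update g' j (comb g' q).
have qj1 : q j = 1 by rewrite /q eqxx.
have gh : same_span g h by move=> a; rewrite gg'; apply: same_span_update.
have small d i : comb h d = 0 -> 0 <= d i < `|c j| -> d i = 0.
  move=> hd /andP[di_ge0 di_lt]; apply/eqP; apply: contraTT di_lt => di0.
  rewrite -leNgt -[d i]gez0_abs // -abszE lez_nat cjk kmin //.
  apply/asboolP; split; first by rewrite absz_gt0.
  by exists h, d, i.
have modK m : 0 <= (m %% c j)%Z < `|c j| by rewrite modz_ge0 ?ltz_mod.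
have hj : h j *~ c j = 0.
  pose d i := if i == j then c j else (c i %% c j)%Z.
  have hd : comb h d = 0.
    rewrite -g'c comb_update; apply: eq_comb => i; rewrite /d /q eqxx.
    case: eqP => [->|_]; first by rewrite mulr1 add0r.
    by rewrite addrC mulrC -divz_eq.
  rewrite -comb_single -hd; apply: eq_comb => i; rewrite {1}/d.
  case: eqP => // /eqP ij; apply/esym; have /= := small d i hd.
  by rewrite /d (negPf ij); apply.
exists h, j, k; split=> // [|d hd].
  rewrite -cjk abszE; case: (ger0P (c j)) => _ //.
  by rewrite mulrNz hj oppr0.
rewrite -cjk /dvdz absz_id -/(dvdz _ _).
apply/dvdz_mod0P; pose d' i := if i == j then (d j %% c j)%Z else d i.
have hd' : comb h d' = 0.
  have -> : comb h d' = comb h d - h j *~ ((d j %/ c j)%Z * c j).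
    rewrite -comb_single combB; apply: eq_comb => i; rewrite /d'.
    by case: eqP => [->|];
      rewrite ?subr0 // {2}(divz_eq (d j) (c j)) addrC addKr.
  by rewrite hd mulrC mulrzA hj mul0rz subr0.
by have := small d' j hd'; rewrite /d' eqxx; apply.
Qed.

Lemma cyclic_decomposition n (g : 'I_n -> A) :
  exists r (e : 'I_r -> A) o, [/\ forall j, o j != 1%N, same_span g e
    & forall c, comb e c = 0 <-> forall j, ((o j)%:Z %| c j)%Z].
Proof.
elim: n g => [|n IHn] g.
  exists 0, g, (fun=> 0); split=> // c; split=> [_ []//|_].
  by rewrite /comb big_ord0.
have [/minimal_relation[h [j [k [gh k_gt0 hjk kdvd]]]]|norel] :=
  pselect (exists2 c, comb g c = 0 & exists j, c j != 0); last first.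
  exists n.+1, g, (fun=> 0); split=> // c; split=> [gc j|c0].
    by rewrite dvd0z; apply/negPn/negP => cj; apply: norel; exists c;
      last exists j.
  rewrite /comb big1 // => j _; have := c0 j.
  by rewrite dvd0z => /eqP ->; rewrite mulr0z.
have [r [e [o [o1 he erel]]]] := IHn (fun i => h (lift j i)).
have hcons a : (exists c, a = comb h c) <->
    (exists c, a = comb (ord_cons (h j) e) c).
  split=> -[c ->].
    rewrite (comb_lift _ j).
    have [|d ->] := (he (comb (fun i => h (lift j i)) (fun i => c (lift j
      i)))).1.
      by eexists.
    exists (ord_cons (c j) d); rewrite comb_cons ord_cons0; congr (_ + _).
    by apply: eq_comb => i; rewrite ord_consS.
  rewrite comb_cons.
  have [|d ->] := (he (comb e (fun i => c (lift ord0 i)))).2; first by eexists.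
  exists (fun i => if unlift j i is Some i' then d i' else c ord0).
  rewrite (comb_lift _ j) unlift_none; congr (_ + _).
  by apply: eq_comb => i; rewrite liftK.
have [k1|k1] := eqVneq k 1%N.
  exists r, e, o; split=> // a; rewrite gh hcons.
  move: hjk; rewrite k1 mulr1z => hj0; split=> -[c ->].
    by rewrite comb_cons hj0 mul0rz add0r; eexists.
  exists (ord_cons 0 c); rewrite comb_cons hj0 mul0rz add0r.
  by apply: eq_comb => i; rewrite ord_consS.
exists r.+1, (ord_cons (h j) e), (ord_cons k o); split=> [i|a|c].
- by rewrite /ord_cons; case: unliftP.
- by rewrite gh hcons.
rewrite comb_cons; split=> [c0 i|oc].
  have [|d Dd] := (he (comb e (fun i => c (lift ord0 i)))).2; first by eexists.
  have c0k : (k%:Z %| c ord0)%Z.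
    pose d' i := if unlift j i is Some i' then d i' else c ord0.
    have := kdvd d'; rewrite /d' unlift_none; apply.
    rewrite (comb_lift _ j) unlift_none -c0 Dd; congr (_ + _).
    by apply: eq_comb => i'; rewrite liftK.
  have hc0 : h j *~ c ord0 = 0.
    by have /dvdzP[m ->] := c0k; rewrite mulrC mulrzA hjk mul0rz.
  move: c0; rewrite hc0 add0r => /erel eo.
  by rewrite /ord_cons; case: unliftP => [i' ->|->].
have -> : comb e (fun i => c (lift ord0 i)) = 0.
  by apply/erel => i; have := oc (lift ord0 i); rewrite ord_consS.
have := oc ord0; rewrite ord_cons0 => /dvdzP[m ->].
by rewrite mulrC mulrzA hjk mul0rz addr0.
Qed.

End Bases.

(** * Three rows over an abelian group with an involution *)

Section RowSystems.
Local Open Scope ring_scope.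

Definition add_subgroup (A : zmodType) (B : A -> Prop) :=
  B 0 /\ forall v w, B v -> B w -> B (v - w).

Definition direct_sum (A : zmodType) (B C : A -> Prop) :=
  [/\ add_subgroup B, add_subgroup C,
      forall v, exists b c, [/\ B b, C c & v = b + c]
    & forall v, B v -> C v -> v = 0].

(** Here T a b c stands for: a, b and c represent, modulo 2 A, the rows
    l(x), l(y) and l(u) for some nonassociating triple x, y, u. Row
    operations come from changes of the triple. *)
Record row_system (A : zmodType) (s : A) (T : A -> A -> A -> Prop) : Prop := {
  row_ex : exists a b c, T a b c;
  row_swapl : forall a b c, T a b c -> T b a c;
  row_swapr : forall a b c, T a b c -> T a c b;
  row_add : forall a b c, T a b c -> T (a + b) b c;
  row_double : forall a b c d, T a b c -> T (a + d + d) b c;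
  row_indecomposable : forall a b c (B C : A -> Prop), T a b c ->
    direct_sum B C -> B s -> B a -> B b -> B c -> forall v, C v -> v = 0
}.

(** The orders of the components that cannot be split off: infinite, or a
    nontrivial power of 2. *)
Definition even_order n := n = 0%N \/ exists k, n = (2 ^ k.+1)%N.

Lemma even_order_half n : even_order n -> (n = 2 * n./2)%N.
Proof.
by case=> [-> //|[k ->]]; rewrite expnS mul2n doubleK mul2n.
Qed.

Lemma even_order_neq1 n : even_order n -> n != 1%N.
Proof.
case=> [->|[k ->]] //; apply/eqP => /(congr1 odd).
by rewrite expnS mul2n odd_double.
Qed.

Lemma odd_factor n : (0 < n)%N -> exists k m, [/\ n = (2 ^ k * m)%N, odd m & (0
  < m)%N].
Proof.
move=> n_gt0; exists (logn 2 n), (n`_2^')%N.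
rewrite -p_part partnC // part_gt0; split=> //.
by have := part_pnat 2%N^' n; rewrite p'natE // dvdn2 negbK.
Qed.

Lemma sort_triple (X : Type) (P : X -> X -> X -> Prop) (key : X -> nat) :
  (forall a b c, P a b c -> P b a c) -> (forall a b c, P a b c -> P a c b) ->
  forall a b c, P a b c -> exists a b c,
    [/\ P a b c, (key a <= key b)%N & (key b <= key c)%N].
Proof.
move=> swapl swapr a b c abc.
have bac := swapl _ _ _ abc; have acb := swapr _ _ _ abc.
have bca := swapr _ _ _ bac; have cab := swapl _ _ _ acb.
have cba := swapr _ _ _ cab.
have [ab|/ltnW ab] := leqP (key a) (key b);
have [bc|/ltnW bc] := leqP (key b) (key c);
have [ac|/ltnW ac] := leqP (key a) (key c).
- by exists a, b, c.
- by exists a, b, c.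
- by exists a, c, b.
- by exists c, a, b.
- by exists b, a, c.
- by exists b, c, a.
- by exists c, b, a.
by exists c, b, a.
Qed.

Section RowSystem.
Variables (A : zmodType) (s : A) (T : A -> A -> A -> Prop).
Hypothesis rows : row_system s T.
Hypotheses (s_neq0 : s != 0) (s2 : s + s = 0).
Implicit Types (a b c d : A).

Lemma row_double23 p a b d f : T p a b -> T p (a + d + d) (b + f + f).
Proof.
move=> Tpab; apply: (row_swapl rows); apply: (row_double rows).
apply: (row_swapr rows); apply: (row_swapl rows); apply: (row_double rows).
by apply: (row_swapl rows); apply: (row_swapr rows); apply: (row_swapl rows).
Qed.

(** Rows count modulo 2 A only, so a summand in which every element is a
    double can be removed from them. *)
Lemma row_indecomposable_mod2 (B C : A -> Prop) : direct_sum B C -> B s ->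
  (forall v, C v -> exists2 w, C w & v = w + w) -> forall v, C v -> v = 0.
Proof.
move=> BC Bs C2.
have toB v : exists2 w, B (v + w + w) & True.
  have [_ [_ CB] gen _] := BC; have [b [c [Bb Cc ->]]] := gen v.
  have [w Cw ->] := C2 c Cc; exists (- w) => //.
  by rewrite addrA !addrK.
have [a [b [c Tabc]]] := row_ex rows.
have [[a' Ba _] [b' Bb _] [c' Bc _]] := And3 (toB a) (toB b) (toB c).
apply: (row_indecomposable rows _ BC Bs Ba Bb Bc).
by apply: row_double23; apply: (row_double rows).
Qed.

Section Basis.
Variables (r : nat).
Implicit Types (e : 'I_r -> A) (o : 'I_r -> nat).

Lemma multiples_subgroup a : add_subgroup (fun v => exists n, v = a *~ n).
Proof.
split=> [|_ _ [m ->] [n ->]]; first by exists 0; rewrite mulr0z.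
by exists (m - n); rewrite mulrzBr.
Qed.

Lemma coordinate_subgroup e j (m : int) :
  add_subgroup (fun v => exists2 c, v = comb e c & (m %| c j)%Z).
Proof.
split=> [|_ _ [c -> mc] [d -> md]].
  by exists (fun=> 0); [rewrite comb0 | exact: dvdz0].
by exists (fun i => c i - d i); rewrite ?combB // rpredB.
Qed.

Lemma basis_single e o j n : basis e o ->
  (e j *~ n = 0) <-> ((o j)%:Z %| n)%Z.
Proof.
move=> [_ rel]; rewrite -comb_single rel; split=> [/(_ j)|on i].
  by rewrite eqxx.
by case: eqP => [->//|_]; rewrite dvdz0.
Qed.

(** The component of e j splits according to the coprime factors p and q of
    its order. For p = 1 it is split off as a whole; this includes infinite
    order, where q = 0. *)
Lemma coordinate_direct_sum e o j (p q : nat) : basis e o ->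
  o j = (p * q)%N -> coprime p q ->
  direct_sum (fun v => exists2 c, v = comb e c & (q%:Z %| c j)%Z)
             (fun v => exists n, v = e j *~ p *~ n).
Proof.
move=> eo ojpq cop.
split; [exact: coordinate_subgroup | exact: multiples_subgroup | |].
- move=> v; have [gen _] := eo; have [c ->] := gen v.
  have [u [w uw]] := Bezoutz p q.
  have {}uw : u * p%:Z + w * q%:Z = 1.
    by rewrite uw /gcdz /= (eqP cop).
  exists (comb e (fun i => if i == j then c j * w * q%:Z else c i)).
  exists (e j *~ p *~ (c j * u)); split=> //; last 1 first.
  + rewrite -mulrzA -comb_single combD; apply: eq_comb => i.
    case: eqP => [->|_]; last by rewrite addr0.
    by rewrite -[LHS]mulr1 -uw; lia.
  + exists (fun i => if i == j then c j * w * q%:Z else c i) => //.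
    by rewrite eqxx dvdz_mull // dvdzz.
  by exists (c j * u).
move=> _ [c -> qc] [n En]; rewrite En -mulrzA; apply/(basis_single _ _ eo).
have : ((p * q)%:Z %| c j - p%:Z * n)%Z.
  have [_ rel] := eo; rewrite -ojpq.
  have /rel/(_ j) : comb e (fun i => c i - if i == j then p%:Z * n else 0) = 0.
    by rewrite -combB comb_single En mulrzA subrr.
  by rewrite eqxx.
rewrite ojpq PoszM => pqn; apply: dvdz_mul; first exact: dvdzz.
have : (q%:Z %| p%:Z * n)%Z.
  rewrite -(subKr (c j) (p%:Z * n)) rpredB //.
  by apply: dvdz_trans pqn; apply: dvdz_mull; apply: dvdzz.
by rewrite Gauss_dvdzr // /coprimez /gcdz /= gcdnC.
Qed.

(** The part of odd order of a component consists of doubles and does not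
    meet s. *)
Lemma order_2power e o j : basis e o -> o j != 1%N -> even_order (o j).
Proof.
move=> eo oj1; have [->|oj_gt0] := posnP (o j); first by left.
have [k [m [ojkm odd_m m_gt0]]] := odd_factor oj_gt0.
have cop : coprime (2 ^ k) m by rewrite coprimeXl // coprime2n.
have BC := coordinate_direct_sum eo ojkm cop.
have [gen rel] := eo.
have C0 : e j *~ (2 ^ k)%N%:Z = 0.
  apply: (row_indecomposable_mod2 BC); last by exists 1; rewrite mulr1z.
    have [c Ds] := gen s; exists c => //.
    have /rel/(_ j) : comb e (fun i => c i + c i) = 0 by rewrite -combD -Ds.
    rewrite ojkm PoszM => /(dvdz_trans (dvdz_mull _ (dvdzz _))).
    rewrite -mulr2n -mulr_natr mulrC Gauss_dvdzr //.
    by move: odd_m; rewrite -coprimen2 /coprimez /gcdz => /eqP ->.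
  move=> _ [n ->]; pose h := m./2; have m2h : m = (h.*2.+1)%N.
    by rewrite -[LHS]odd_double_half odd_m.
  exists (e j *~ (2 ^ k)%N%:Z *~ (n * - h%:Z)); first by eexists.
  have em0 : e j *~ (2 ^ k)%N%:Z *~ m = 0.
    by rewrite -mulrzA; apply/(basis_single _ _ eo); rewrite ojkm PoszM dvdzz.
  have En : n = m%:Z * n + (n * - h%:Z + n * - h%:Z) by rewrite m2h; lia.
  by rewrite [in LHS]En mulrzDr mulrzA em0 mul0rz add0r mulrzDr.
right; move: C0 => /(basis_single _ _ eo); rewrite ojkm dvdzE !absz_nat.
rewrite -[X in (_ %| X)%N]muln1 dvdn_pmul2l ?expn_gt0 // dvdn1 => /eqP m1.
move: oj1; rewrite ojkm m1 muln1; case: k {ojkm cop BC} => // k _.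
by exists k.
Qed.
Lemma even_order_dvdn m n : even_order m -> even_order n -> (0 < m)%N ->
  (m <= n)%N -> (m %| n)%N.
Proof.
case=> [->|[k ->]] // [->|[l ->]]; first by rewrite dvdn0.
by move=> _; rewrite leq_exp2l // => kl; rewrite dvdn_exp2l.
Qed.

(** An element of order 2 has the coordinate n / 2 wherever it is not
    trivial. *)
Lemma half_relation (n : nat) (c : int) : even_order n -> (n%:Z %| c + c)%Z ->
  ~~ (n%:Z %| c)%Z -> (0 < n)%N /\ (n%:Z %| c - n./2%:Z)%Z.
Proof.
move=> /even_order_half n2; have [->|n_gt0] := posnP n.
  by rewrite !dvd0z; lia.
move: n2; set h := n./2 => n2 /dvdzP[m Em] ndv; split=> //.
have Dm := divz_eq m 2; have mod2 : (m %% 2)%Z = 0 \/ (m %% 2)%Z = 1.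
  by have := modz_ge0 m (isT : 2 != 0 :> int);
    have := ltz_pmod m (isT : 0 < 2 :> int); lia.
have Ec : c = m * h%:Z by rewrite n2 PoszM in Em; lia.
have nt t : (n%:Z %| t * 2 * h%:Z)%Z.
  by apply/dvdzP; exists t; rewrite {1}n2 PoszM mulrA.
case: mod2 => mod2; rewrite mod2 in Dm; last first.
  by rewrite Ec Dm mulrDl mul1r addrK.
by case/negP: ndv; rewrite Ec Dm addr0.
Qed.

(** Let i be a component of least order among those that s involves. The
    orders of the others are multiples of o i, so that half of the order of
    each e j can be divided by half of o i. *)
Lemma basis_through_involution e o : basis e o -> (forall j, even_order (o j))
  ->
  exists e' i, [/\ basis e' o, (0 < o i)%N & s = e' i *~ (o i)./2].
Proof.
move=> eo evo; have [gen rel] := eo; have [c Ds] := gen s.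
pose S j := ~~ ((o j)%:Z %| c j)%Z.
have Shalf j : S j -> (0 < o j)%N /\ ((o j)%:Z %| c j - (o j)./2%:Z)%Z.
  apply: half_relation => //.
  by have /rel/(_ j) : comb e (fun i => c i + c i) = 0 by rewrite -combD -Ds.
have [j0 Sj0] : exists j, S j.
  apply/existsP; apply: contraNT s_neq0; rewrite negb_exists => /forallP nS.
  by rewrite Ds; apply/eqP/rel => j; have /negPn := nS j.
case: (arg_minnP o Sj0) => i Si imin.
have [oi_gt0 _] := Shalf i Si.
pose d j := if S j then (o j %/ o i)%N%:Z else 0.
have odvd j : S j -> (o i %| o j)%N.
  by move=> Sj; apply: even_order_dvdn => //; apply: imin.
exists (update e i (comb e d)), i; split=> //.
  apply: basis_update => //; first by rewrite /d Si divnn oi_gt0.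
  move=> j; rewrite /d; case: ifP => [Sj|_]; last by rewrite mulr0 dvdz0.
  by rewrite -PoszM mulnC divnK ?dvdzz // odvd.
rewrite /update eqxx combMz Ds; apply/eqP; rewrite -subr_eq0 combB.
apply/eqP/rel => j; rewrite /d; case: ifP => [Sj|/negbFE //]; last first.
  by rewrite mul0r subr0.
have [_] := Shalf j Sj; congr (_ %| _ - _)%Z.
rewrite -PoszM; congr Posz.
have oj2 := even_order_half (evo j); have oi2 := even_order_half (evo i).
have := divnK (odvd j Sj); set q := (o j %/ o i)%N => qE.
by apply/eqP; rewrite -(eqn_pmul2l (isT : 0 < 2)%N) -oj2 mulnCA -oi2 qE.
Qed.
(** A row can replace e i if the orders of the other elements involved
    divide o i. If i = i1 they have to divide o i / 2, in order not to
    change s = (o i / 2) e i. So components are ordered by the logarithm of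
    their orders, infinity being the largest, and i1 comes before the others
    with the same order. *)
Lemma elimination_order o i1 : (forall j, even_order (o j)) -> (0 < o i1)%N ->
  exists pos : 'I_r -> nat, injective pos /\ forall j i, (pos j < pos i)%N ->
    (o j %| o i)%N /\ (i = i1 -> (o j %| (o i)./2)%N).
Proof.
move=> evo oi1_gt0; have r_gt0 : (0 < r)%N by case: (r) i1 {oi1_gt0} => [[]|].
pose rho j := if o j == 0%N then (\max_k logn 2 (o k)).+1 else logn 2 (o j).
have rho_fin j : (rho j <= \max_k logn 2 (o k))%N -> o j = (2 ^ rho j)%N.
  rewrite /rho; case: eqP => [_|]; first by rewrite ltnn.
  by case: (evo j) => [-> /(_ erefl)//|[k ->]] _ _; rewrite pfactorK.
have dvd_rho j k : (rho j <= k <= \max_k logn 2 (o k))%N -> (o j %| 2 ^ k)%N.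
  case/andP=> jk kmax; rewrite rho_fin ?(leq_trans jk) //.
  exact: dvdn_exp2l.
have rho_dvd j i : (rho j <= rho i)%N -> (o j %| o i)%N.
  have [->|oi0] := eqVneq (o i) 0%N; first by rewrite dvdn0.
  have imax : (rho i <= \max_k logn 2 (o k))%N.
    by rewrite /rho (negPf oi0); apply: (leq_bigmax i).
  by move=> ji; rewrite (rho_fin i) // dvd_rho // ji.
pose key j := ((rho j).*2 + (j != i1))%N.
pose pos j := (key j * r + j)%N.
have posE j : (pos j %% r)%N = j by rewrite modnMDl modn_small.
exists pos; split=> [j i /(congr1 (modn^~ r))|j i ltji].
  by rewrite !posE => /val_inj.
have lekey : (key j <= key i)%N.
  rewrite leqNgt; apply: contraL ltji => ltij; rewrite -leqNgt /pos.
  have ltir := ltn_ord i.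
  apply: (@leq_trans ((key i).+1 * r)%N); first by rewrite mulSn; lia.
  by apply: leq_trans (leq_addr _ _); rewrite leq_mul2r ltij orbT.
split=> [|Di].
  by apply: rho_dvd; move: lekey; rewrite /key; case: eqP; case: eqP; lia.
have ji1 : j != i1.
  by apply: contraTneq ltji => ->; rewrite Di ltnn.
move: lekey; rewrite /key ji1 Di eqxx => /= lekey.
have imax : (rho i1 <= \max_k logn 2 (o k))%N.
  by rewrite /rho eqn0Ngt oi1_gt0; apply: (leq_bigmax i1).
have rho1 : (0 < rho i1)%N by lia.
rewrite (rho_fin i1) // -(prednK rho1) expnS mul2n doubleK dvd_rho //; lia.
Qed.
Implicit Types (v w t : {ffun 'I_r -> bool}).

Definition row_value e v := comb e (fun j => (v j : nat)%:Z).

Definition row_xor v w := [ffun j => v j (+) w j].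

Lemma row_value_xor e v w : exists d,
  row_value e v + row_value e w + d + d = row_value e (row_xor v w).
Proof.
exists (- comb e (fun j => (v j && w j : nat)%:Z)).
rewrite combN !combD; apply: eq_comb => j; rewrite ffunE.
by case: (v j) (w j) => [] [].
Qed.

Lemma row_value_exists e o a : basis e o ->
  exists v d, a + d + d = row_value e v.
Proof.
move=> [gen _]; have [c ->] := gen a.
exists [ffun j => (c j %% 2)%Z == 1], (- comb e (fun j => (c j %/ 2)%Z)).
rewrite combN !combD; apply: eq_comb => j; rewrite ffunE.
have := divz_eq (c j) 2; have := modz_ge0 (c j) (isT : 2 != 0 :> int).
have := ltz_pmod (c j) (isT : 0 < 2 :> int).
by case: eqP; lia.
Qed.

Section Reduction.
Variables (e : 'I_r -> A) (o : 'I_r -> nat) (pos : 'I_r -> nat).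
Hypotheses (eo : basis e o) (pos_inj : injective pos).
Definition leading v i := v i /\ forall j, v j -> j != i -> (pos j < pos i)%N.

Lemma leading_exists v : v != [ffun=> false] -> exists i, leading v i.
Proof.
move=> v0; have [j vj] : exists j, v j.
  apply/existsP; apply: contraNT v0; rewrite negb_exists => /forallP vF.
  by apply/eqP/ffunP => j; rewrite ffunE; apply: negbTE.
case: (arg_maxnP pos vj) => i vi imax; exists i; split=> // k vk ki.
rewrite ltn_neqAle (inj_eq pos_inj) ki; exact: imax.
Qed.

(** Rows are compared as numbers, with a digit for each position; the base
    r.+1 makes the sum of all lower digits less than one unit of the
    position. *)
Definition weight v := (\sum_j v j * r.+1 ^ pos j)%N.

Lemma weight_xor v w i : leading v i -> w i -> (weight (row_xor v w) < weight
  w)%N.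
Proof.
move=> [vi vlt] wi; rewrite /weight (bigD1 i) // [X in (_ < X)%N](bigD1 i) //=.
rewrite ffunE vi wi mul0n mul1n add0n.
apply: (@leq_ltn_trans (\sum_(j | j != i) (v j * r.+1 ^ pos j + w j * r.+1 ^
  pos j))%N).
  apply: leq_sum => j _; rewrite ffunE -mulnDl leq_mul2r; apply/orP; right.
  by case: (v j) (w j) => [] [].
rewrite big_split ltn_add2r -(ltn_pmul2l (ltn0Sn r)) big_distrr /=.
apply: (@leq_ltn_trans (\sum_(j | j != i) r.+1 ^ pos i)%N).
  apply: leq_sum => j ji; case vj: (v j); last by rewrite mul0n muln0.
  by rewrite mul1n -expnS leq_pexp2l // vlt.
apply: (@leq_ltn_trans (\sum_(j < r) r.+1 ^ pos i)%N).
  by rewrite [X in (_ <= X)%N](bigD1 i) //= leq_addl.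
by rewrite sum_nat_const card_ord ltn_pmul2r // expn_gt0.
Qed.

Definition row_triple v w t := T (row_value e v) (row_value e w) (row_value e
  t).

Definition minimal_triple v w t := row_triple v w t /\
  forall v' w' t', row_triple v' w' t' ->
    (weight v + weight w + weight t <= weight v' + weight w' + weight t')%N.

Lemma minimal_triple_swapl v w t : minimal_triple v w t -> minimal_triple w v t.
Proof.
move=> [vwt min]; split; first exact: row_swapl rows _ _ _ vwt.
by rewrite (addnC (weight w)).
Qed.

Lemma minimal_triple_swapr v w t : minimal_triple v w t -> minimal_triple v t w.
Proof.
move=> [vwt min]; split; first exact: row_swapr rows _ _ _ vwt.
by rewrite addnAC.
Qed.

Lemma row_triple_exists a b c : T a b c -> exists v w t, row_triple v w t.
Proof.
move=> Tabc; have [v [a' Ea]] := row_value_exists a eo.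
have [w [b' Eb]] := row_value_exists b eo.
have [t [c' Ec]] := row_value_exists c eo.
exists v, w, t; rewrite /row_triple -Ea -Eb -Ec.
by apply: row_double23; apply: (row_double rows).
Qed.

Lemma minimal_triple_exists : exists v w t, minimal_triple v w t.
Proof.
have [a [b [c /row_triple_exists[v [w [t vwt]]]]]] := row_ex rows.
pose P n := `[< exists v w t, row_triple v w t /\
                  n = (weight v + weight w + weight t)%N >].
have exP : exists n, P n.
  by exists (weight v + weight w + weight t)%N; apply/asboolP; exists v, w, t.
case: (ex_minnP exP) => n /asboolP[v1 [w1 [t1 [T1 ->]]]] min.
exists v1, w1, t1; split=> // v' w' t' T'; apply: min; apply/asboolP.
by exists v', w', t'.
Qed.

(** Adding v to w removes the pivot from w and changes only lower positions,
    so it would lower the weight. Hence a triple of least weight is in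
    reduced echelon form. *)
Lemma minimal_triple_reduced v w t i : minimal_triple v w t ->
  leading v i -> w i = false.
Proof.
move=> [vwt min] lead; apply/negP => wi.
have [d Ed] := row_value_xor e w v.
have xorC : row_xor w v = row_xor v w by apply/ffunP => j; rewrite !ffunE addbC.
have : row_triple v (row_xor v w) t.
  rewrite /row_triple -xorC -Ed; apply: (row_swapl rows).
  by apply: (row_double rows); apply: (row_add rows); apply: (row_swapl rows).
move/min; have := weight_xor lead wi; lia.
Qed.

End Reduction.

Definition involution_basis e o i1 := [/\ basis e o, forall j, even_order (o j),
  (0 < o i1)%N & s = e i1 *~ (o i1)./2].

(** The summand s is there because the square of x is s l(x): after this
    step the pivot elements, and not their translates by s, are squares of
    members of the triple. It is left out at i1, where the pivot element may
    be s itself. *)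
Definition elimination_step e i1 v l :=
  update e l (row_value e v + (if l == i1 then 0 else s)).

Lemma elimination_step_value e i1 v l w : w l = false ->
  row_value (elimination_step e i1 v l) w = row_value e w.
Proof.
move=> wl; apply: eq_bigr => j _; rewrite /elimination_step /update.
by case: eqP => [->|//]; rewrite wl !mulr0z.
Qed.

Lemma elimination_step_basis e o i1 pos v l : involution_basis e o i1 ->
  (forall j i, (pos j < pos i)%N ->
    (o j %| o i)%N /\ (i = i1 -> (o j %| (o i)./2)%N)) ->
  leading pos v l -> involution_basis (elimination_step e i1 v l) o i1.
Proof.
move=> [eo evo oi1_gt0 Ds] pos_dvd [vl vlt].
have dvd_l j : v j -> (o j %| o l)%N.
  by have [->//|jl vj] := eqVneq j l; have [] := pos_dvd _ _ (vlt j vj jl).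
split=> //.
  pose c j := (v j : nat)%:Z
               + (if j == i1 then if l == i1 then 0 else (o i1)./2%:Z else 0).
  rewrite /elimination_step (_ : row_value e v + _ = comb e c).
    apply: basis_update => // [|j].
      by rewrite /c vl; case: (l == i1); rewrite addr0.
    rewrite /c mulrDr rpredD //.
      by case vj: (v j); rewrite ?mulr0 ?dvdz0 // mulr1; apply: dvd_l.
    case: eqP => [->|_]; last by rewrite mulr0 dvdz0.
    case: eqP => [_|_]; first by rewrite mulr0 dvdz0.
    rewrite (even_order_half (evo l)) -PoszM -mulnA mulnCA.
    rewrite -(even_order_half (evo i1)); exact: dvdn_mull.
  rewrite -combD comb_single; congr (_ + _).
  by case: eqP; rewrite ?mulr0z.
rewrite /elimination_step /update eq_sym; case: eqP => // Dl; subst l.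
rewrite addr0 combMz Ds; apply/eqP; rewrite -subr_eq0 -comb_single combB.
apply/eqP; have [_ rel] := eo; apply/rel => j.
have [->|ji1] := eqVneq j i1; first by rewrite vl mul1r subrr dvdz0.
case vj: (v j); last by rewrite mul0r subr0 dvdz0.
rewrite mul1r sub0r; have [_ /(_ erefl)] := pos_dvd _ _ (vlt j vj ji1).
by rewrite dvdzE abszN !absz_nat.
Qed.

Section Elimination.
Variables (e : 'I_r -> A) (o : 'I_r -> nat) (i1 : 'I_r) (pos : 'I_r -> nat).
Hypotheses (eoi : involution_basis e o i1) (pos_inj : injective pos).
Hypothesis pos_dvd : forall j i, (pos j < pos i)%N ->
    (o j %| o i)%N /\ (i = i1 -> (o j %| (o i)./2)%N).
Variable lead : {ffun 'I_r -> bool} -> 'I_r.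
Hypothesis leadP : forall v, v != [ffun=> false] -> leading pos v (lead v).

Definition eliminate f v :=
  if v == [ffun=> false] then f else elimination_step f i1 v (lead v).

Lemma eliminate_basis f v : involution_basis f o i1 ->
  involution_basis (eliminate f v) o i1.
Proof.
rewrite /eliminate; case: ifPn => // v0 fo.
exact: elimination_step_basis pos_dvd (leadP v0).
Qed.

Lemma eliminate_value f v w : (v != [ffun=> false] -> w (lead v) = false) ->
  row_value (eliminate f v) w = row_value f w.
Proof.
by rewrite /eliminate; case: ifPn => // _ /(_ isT);
  apply: elimination_step_value.
Qed.

Lemma eliminate_pivot f v : v != [ffun=> false] ->
  eliminate f v (lead v) = row_value f v + (if lead v == i1 then 0 else s).
Proof.
by move=> /negPf v0; rewrite /eliminate v0 /elimination_step /update eqxx.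
Qed.

Lemma eliminate_other f v w : w != [ffun=> false] ->
  (v != [ffun=> false] -> w (lead v) = false) ->
  eliminate f v (lead w) = f (lead w).
Proof.
move=> /leadP[wl _]; rewrite /eliminate; case: ifPn => // _ /(_ isT) wv.
rewrite /elimination_step /update; case: eqP => // eq_l.
by rewrite eq_l wv in wl.
Qed.

(** As pivots occur in one row only, each step leaves the other rows and the
    pivots already placed unchanged. *)
Lemma elimination v1 v2 v3 : minimal_triple e pos v1 v2 v3 ->
  exists2 f, involution_basis f o i1 &
    forall v, v \in [:: v1; v2; v3] -> v != [ffun=> false] ->
      f (lead v) = row_value e v + (if lead v == i1 then 0 else s).
Proof.
move=> min; have [eo _ _ _] := eoi.
have red v w t : minimal_triple e pos v w t ->
    v != [ffun=> false] -> w (lead v) = false.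
  by move=> vwt /leadP; apply: minimal_triple_reduced vwt.
have min132 := minimal_triple_swapr min;
  have min213 := minimal_triple_swapl min.
have min231 := minimal_triple_swapr min213.
have min312 := minimal_triple_swapl min132.
have min321 := minimal_triple_swapr min312.
have r12 := red _ _ _ min; have r13 := red _ _ _ min132.
have r21 := red _ _ _ min213; have r23 := red _ _ _ min231.
have r31 := red _ _ _ min312; have r32 := red _ _ _ min321.
exists (eliminate (eliminate (eliminate e v1) v2) v3).
  by do 3![apply: eliminate_basis].
move=> v; rewrite !inE => /or3P[] /eqP -> v0.
- by rewrite eliminate_other // eliminate_other // eliminate_pivot.
- by rewrite eliminate_other // eliminate_pivot // eliminate_value.
by rewrite eliminate_pivot // !eliminate_value.
Qed.

End Elimination.

End Basis.

(** If one of the two rows is 0 and the other is t, add the second to the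
    first. *)
Lemma row_equalize p a b t : T p a b -> a = 0 \/ a = t -> b = 0 \/ b = t ->
  exists2 l, l = 0 \/ l = t & T p l l.
Proof.
have add_to_2nd q v w : T q v w -> T q (v + w) w.
  move=> /(row_swapl rows)/(row_swapr rows)/(row_add rows).
  by move=> /(row_swapr rows)/(row_swapl rows).
move=> Tpab [Da|Da] [Db|Db]; rewrite {}Da {}Db in Tpab.
- by exists 0; first left.
- by exists t; [right | move/add_to_2nd: Tpab; rewrite add0r].
- exists t; [by right|]; apply: (row_swapr rows).
  by move/(row_swapr rows)/add_to_2nd: Tpab; rewrite add0r.
by exists t; first right.
Qed.

Lemma row_equalize3 a b c t : T a b c -> a = 0 \/ a = t -> b = 0 \/ b = t ->
  c = 0 \/ c = t -> exists2 l, l = 0 \/ l = t & T l l l.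
Proof.
move=> Tabc Da Db Dc; have [l Dl Tal] := row_equalize Tabc Db Dc.
have T0tt : T 0 t t -> T t t t by move/(row_add rows); rewrite add0r.
case: Da Dl Tal => [->|->] [->|->] Tal; [by exists 0; first left | | |].
- by exists t; [right | apply: T0tt].
- exists t; [by right | apply: T0tt].
  have := row_add rows (row_swapl rows Tal); rewrite add0r => Ttt0.
  exact: row_swapl rows _ _ _ (row_swapr rows Ttt0).
by exists t; first right.
Qed.

(** If t has order 2 then s = t, and adding s exchanges 0 and t. If the
    order of t is larger then s is a double. *)
Lemma row_epsilon n (t l : A) : even_order n -> (0 < n)%N -> t *~ n = 0 ->
  s = t *~ n./2 -> l = 0 \/ l = t ->
  exists eps d, (eps = 0 \/ eps = t) /\ l + d + d = eps + s.
Proof.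
case=> [->//|[[|k] ->]] _; rewrite expnS mul2n doubleK => tn Ds Dl.
  have {}Ds : s = t by rewrite Ds expn0 mulr1z.
  case: Dl => ->; [exists t | exists 0]; exists 0; rewrite !addr0; split.
  - by right.
  - by rewrite -{1}Ds s2.
  - by left.
  by rewrite add0r Ds.
exists l, (t *~ (2 ^ k)%N); split=> //.
by rewrite -addrA -mulrzDr -PoszD addnn -mul2n -expnS -Ds.
Qed.

(** The elements e j for j in js are the pivots other than e i1, and eps is
    the square shared by the members of the triple that have none of these
    as a square. Listing the components of finite order before those of
    infinite order saves cases later. *)
Theorem row_normal_form n (g : 'I_n -> A) :
  (forall a, exists m, a = comb g m) ->
  exists r (e : 'I_r -> A) (o : 'I_r -> nat) (i1 : 'I_r) (js : seq 'I_r) eps,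
    [/\ involution_basis e o i1,
        [/\ uniq (i1 :: js), forall j, j \in i1 :: js, (size js <= 3)%N
          & sorted (fun j k => (o j == 0%N) <= (o k == 0%N))%N js],
        eps = 0 \/ eps = e i1
      & let x k := nth eps (map e js) k in T (x 0 + s) (x 1 + s) (x 2 + s)].
Proof.
move=> gen_g; have [r [e0 [o [o1 span0 rel0]]]] := cyclic_decomposition g.
have e0o : basis e0 o.
  by split=> // a; apply/span0; have [c ->] := gen_g a; exists c.
have evo j : even_order (o j) by apply: order_2power e0o (o1 j).
have [e1 [i1 [e1o oi1_gt0 Ds1]]] := basis_through_involution e0o evo.
have [pos [pos_inj pos_dvd]] := elimination_order evo oi1_gt0.
have [lead leadP] : {lead : {ffun 'I_r -> bool} -> 'I_r &
    forall v, v != [ffun=> false] -> leading pos v (lead v)}.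
  apply: (@choice _ _ (fun (v : {ffun 'I_r -> bool}) i =>
    v != [ffun=> false] -> leading pos v i)) => v.
  have [->|v0] := eqVneq v [ffun=> false]; first by exists i1; rewrite ?eqxx.
  by have [i vi] := leading_exists pos_inj v0; exists i.
pose z (v : {ffun 'I_r -> bool}) := (v != [ffun=> false]) && (lead v != i1).
pose key v := if z v then (o (lead v) == 0%N : nat) else 2%N.
have [v1' [v2' [v3' min']]] := minimal_triple_exists pos e1o.
have [v1 [v2 [v3 [min k12 k23]]]] := sort_triple key
  (@minimal_triple_swapl _ e1 pos) (@minimal_triple_swapr _ e1 pos) min'.
have [e eoi piv] := elimination (And4 e1o evo oi1_gt0 Ds1) pos_dvd leadP min.
have [eo _ _ Ds] := eoi.
have val_z v : v \in [:: v1; v2; v3] -> z v -> row_value e1 v = e (lead v) + s.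
  move=> v123 /andP[v0 /negPf li1]; rewrite piv // li1.
  by rewrite -addrA s2 addr0.
have val_nz v : v \in [:: v1; v2; v3] -> z v = false ->
    row_value e1 v = 0 \/ row_value e1 v = e i1.
  move=> v123; rewrite /z; have [->|v0] := eqVneq v [ffun=> false].
    by left; rewrite -(comb0 e1); apply: eq_comb => j; rewrite ffunE.
  by case: eqP => // li1 _; right; rewrite -li1 piv // li1 eqxx addr0.
have pivots j : j != i1 -> exists v, [/\ v \in [:: v1; v2;
  v3], z v & j = lead v].
  move=> ji1; apply: contrapT => nopiv.
  have oj1 : o j = (1 * o j)%N by rewrite mul1n.
  have BC := coordinate_direct_sum eo oj1 (coprime1n _).
  have other i : i != j -> exists2 c, e i = comb e c & ((o j)%:Z %| c j)%Z.
    move=> ij; exists (fun k => if k == i then 1 else 0).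
      by rewrite comb_single mulr1z.
    by rewrite eq_sym (negPf ij) dvdz0.
  have [[B0 BB] _ _ _] := BC.
  have BN v : (exists2 c, v = comb e c & ((o j)%:Z %| c j)%Z) ->
      (exists2 c, - v = comb e c & ((o j)%:Z %| c j)%Z).
    by move=> Bv; have := BB _ _ B0 Bv; rewrite sub0r.
  have Bs : exists2 c, s = comb e c & ((o j)%:Z %| c j)%Z.
    have i1j : i1 != j by rewrite eq_sym.
    have [c Dc cj] := other i1 i1j.
    exists (fun k => c k * (o i1)./2%:Z); first by rewrite Ds Dc combMz.
    exact: dvdz_mulr.
  have Brow v : v \in [:: v1; v2; v3] ->
      exists2 c, row_value e1 v = comb e c & ((o j)%:Z %| c j)%Z.
    move=> v123; case zv: (z v).
      rewrite val_z // -[s]opprK; apply: (BB _ (- s)); last exact: BN.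
      by apply: other; apply/eqP => lj; apply: nopiv; exists v.
    have [->//|->] := val_nz v v123 zv.
    by apply: other; rewrite eq_sym.
  have C0 := row_indecomposable rows (proj1 min) BC Bs
    (Brow v1 _) (Brow v2 _) (Brow v3 _).
  have : e j *~ 1 *~ 1 = 0.
    by apply: C0; rewrite ?inE ?eqxx ?orbT //; exists 1.
  rewrite -mulrzA => /(basis_single _ _ eo); rewrite dvdzE /= dvdn1 => /eqP oj.
  by have := even_order_neq1 (evo j); rewrite oj.
have red v w t : minimal_triple e1 pos v w t -> z v -> z w ->
    (lead v == lead w) = false.
  move=> vwt /andP[v0 _] /andP[/leadP[wl _] _]; apply/eqP => eq_l.
  by move: wl; rewrite -eq_l (minimal_triple_reduced vwt (leadP v v0)).
have d12 := red _ _ _ min; have d13 := red _ _ _ (minimal_triple_swapr min).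
have d23 := red _ _ _ (minimal_triple_swapr (minimal_triple_swapl min)).
have [in1 in2 in3] : [/\ v1 \in [:: v1; v2; v3], v2 \in [:: v1; v2; v3]
    & v3 \in [:: v1; v2; v3]] by rewrite !inE !eqxx !orbT.
have min_T : T (row_value e1 v1) (row_value e1 v2) (row_value e1 v3) := proj1
  min.
have e_o1 : e i1 *~ (o i1) = 0 by apply/(basis_single _ _ eo); rewrite dvdzz.
have eps_of l := row_epsilon (evo i1) oi1_gt0 e_o1 Ds (l := l).
pose js := map lead (filter z [:: v1; v2; v3]).
have mem_js j : j \in i1 :: js.
  rewrite inE; have [//|/pivots[v [v123 zv ->]]] := eqVneq j i1.
  by apply: map_f; rewrite mem_filter zv.
have size_js : (size js <= 3)%N.
  by rewrite size_map size_filter (leq_trans (count_size _ _)).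
have li v : z v -> (i1 == lead v) = false.
  by case/andP => _ /negPf; rewrite eq_sym.
have uniq_js : uniq (i1 :: js).
  rewrite /js /=; case z1: (z v1); case z2: (z v2); case z3: (z v3);
  by rewrite /= ?inE ?li ?d12 ?d13 ?d23.
have sorted_js : sorted (fun j k => (o j == 0%N) <= (o k == 0%N))%N js.
  have le2 (b : bool) : (2 <= b)%N = false by case: b.
  move: k12 k23; rewrite /key /js /=.
  by case: (z v1); case: (z v2); case: (z v3) => //=; rewrite ?le2 //;
    do 2?[case: (_ <= _)%N => //].
suff [eps eps01 Teps] : exists2 eps, eps = 0 \/ eps = e i1 &
    let x k := nth eps (map e js) k in T (x 0 + s) (x 1 + s) (x 2 + s).
  by exists r, e, o, i1, js, eps; split.
have znot2 (b : bool) : (2 <= b)%N = false by case: b.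
move: k12 k23; rewrite /key /js /=.
move: (val_z v1 in1) (val_z v2 in2) (val_z v3 in3).
move: (val_nz v1 in1) (val_nz v2 in2) (val_nz v3 in3).
move: min_T.
case: (z v1); case: (z v2); case: (z v3) => //=; rewrite ?znot2 //.
- by move=> Tv _ _ _ /(_ isT) D1 /(_ isT) D2 /(_ isT) D3 _ _; exists 0;
  [left | rewrite -D1 -D2 -D3].
- move=> Tv _ _ /(_ erefl) D3 /(_ isT) D1 /(_ isT) D2 _ _ _.
  have [eps [d [eps01 Deps]]] := eps_of _ D3.
  exists eps => //; rewrite -D1 -D2 -Deps.
  rewrite -[row_value e1 v2]addr0 -[_ + 0]addr0.
  exact: row_double23.
- move=> Tv _ /(_ erefl) D2 /(_ erefl) D3 /(_ isT) D1 _ _ _ _.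
  have [l Dl Tl] := row_equalize Tv D2 D3.
  have [eps [d [eps01 Deps]]] := eps_of _ Dl.
  by exists eps => //; rewrite -D1 -Deps; apply: row_double23.
move=> Tv /(_ erefl) D1 /(_ erefl) D2 /(_ erefl) D3 _ _ _ _ _.
have [l Dl Tl] := row_equalize3 Tv D1 D2 D3.
have [eps [d [eps01 Deps]]] := eps_of _ Dl.
exists eps => //; rewrite -Deps.
by apply: row_double23; apply: (row_double rows).
Qed.
End RowSystem.

End RowSystems.

(** * Decompositions of the loop from decompositions of its centre *)

Section RAStructureTheory.
Variables (L : umagmaType) (A : zmodType) (i : A -> L) (s : A).
Hypothesis st : RA_structure i s.
Hypothesis RA_L : RA_loop L.
Implicit Types (a b c d g h x y u : L) (p q z : A).

Let emb := RA_emb st.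
Let iC := centerC emb.
Let iA := center_mulA emb.
Let iCA := center_mulCA RA_L emb.
Let iD := center_mulD emb.
Let i0 := center_mul0 emb.

Lemma embedding_inj : injective i. Proof. by have [] := emb. Qed.

Lemma embedding0 : i 0%R = 1. Proof. by have [] := emb. Qed.

Lemma embeddingD p q : i (p + q)%R = i p * i q.
Proof. by have [] := emb. Qed.

Lemma nonassocMl a b c d :
  nonassoc (a * b) c d = nonassoc a c d (+) nonassoc b c d.
Proof. by rewrite !(RA_nonassoc_rot st _ c d) (RA_nonassocM st). Qed.

Lemma nonassoc_center p a b : nonassoc (i p) a b = false.
Proof. by rewrite /nonassoc iA eqxx. Qed.

Lemma noncomm_center p a : noncomm (i p) a = false.
Proof. by rewrite /noncomm iC eqxx. Qed.

Lemma nonassoc_aab a b : nonassoc a a b = false.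
Proof. by rewrite /nonassoc (associates_aab RA_L) eqxx. Qed.

Lemma nonassoc_aba a b : nonassoc a b a = false.
Proof. by rewrite -(RA_nonassoc_rot st) nonassoc_aab. Qed.

Lemma nonassoc_abb a b : nonassoc a b b = false.
Proof. by rewrite (RA_nonassoc_rot st) nonassoc_aab. Qed.

Lemma noncommC a b : noncomm a b = noncomm b a.
Proof. by rewrite /noncomm eq_sym. Qed.

Lemma square_centerl a b : a * (a * b) = (a * a) * b.
Proof. by rewrite (associates_aab RA_L). Qed.

Section ModuloSubgroup.
Variables (x y u : L) (B : A -> Prop).
Hypotheses (subB : add_subgroup B) (Bs : B s).

(** Congruence modulo a central subgroup B that contains s: products may be
    rearranged at will. *)
Definition congruent a b := exists2 p, B p & a = i p * b.

Let BD p q : B p -> B q -> B (p + q)%R.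
Proof.
have [B0 BB] := subB => Bp Bq; rewrite -[q]opprK; apply: (BB) => //.
by rewrite -[X in B X]add0r; apply: BB.
Qed.

Let BN p : B p -> B (- p)%R.
Proof. by have [B0 BB] := subB => Bp; rewrite -sub0r; apply: BB. Qed.

Lemma congruent_refl a : congruent a a.
Proof. by exists 0%R; rewrite ?i0 //; have [] := subB. Qed.

Lemma congruent_trans b a c : congruent a b -> congruent b c -> congruent a c.
Proof.
by move=> [p Bp ->] [q Bq ->]; exists (p + q)%R; rewrite ?iD //; apply: BD.
Qed.

Lemma congruent_sym a b : congruent a b -> congruent b a.
Proof.
move=> [p Bp ->]; exists (- p)%R; first exact: BN.
by rewrite iD addNr i0.
Qed.

Lemma congruentM a b c d : congruent a b -> congruent c d ->
  congruent (a * c) (b * d).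
Proof.
move=> [p Bp ->] [q Bq ->]; exists (p + q)%R; first exact: BD.
by rewrite iA iCA iD.
Qed.

Let Bbit (e : bool) : B (s *+ e)%R.
Proof. by case: e => //; have [] := subB. Qed.

Lemma congruentC a b : congruent (a * b) (b * a).
Proof. by rewrite (RA_mulC st a b); eexists; last by []. Qed.

Lemma congruentA a b c : congruent (a * b * c) (a * (b * c)).
Proof. by rewrite (RA_mulA st a b c); eexists; last by []. Qed.

Lemma congruentACA a b c d : congruent ((a * b) * (c * d)) ((a * c) * (b * d)).
Proof.
apply: congruent_trans (congruentA _ _ _) _.
apply: congruent_trans (congruent_sym (congruentA _ _ _)).
apply: congruentM; first exact: congruent_refl.
apply: congruent_trans (congruent_sym (congruentA _ _ _)) _.
apply: congruent_trans (congruentA _ _ _).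
apply: congruentM; [exact: congruentC | exact: congruent_refl].
Qed.

Definition monomial e1 e2 e3 := power_bit x e1 * power_bit y e2 * power_bit u
  e3.

Definition monomial_set : set L :=
  [set g | exists e1 e2 e3, congruent g (monomial e1 e2 e3)].

Hypotheses (Bx : exists2 p, B p & x * x = i p)
  (By : exists2 p, B p & y * y = i p) (Bu : exists2 p, B p & u * u = i p).

Lemma power_bitM a e f : (exists2 p, B p & a * a = i p) ->
  congruent (power_bit a e * power_bit a f) (power_bit a (e (+) f)).
Proof.
case: e f => [] [] /= [p Bp Ea];
  rewrite ?mul1g ?mulg1; try exact: congruent_refl.
by exists p; rewrite // Ea mulg1.
Qed.

Lemma monomialM e1 e2 e3 f1 f2 f3 :
  congruent (monomial e1 e2 e3 * monomial f1 f2 f3)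
            (monomial (e1 (+) f1) (e2 (+) f2) (e3 (+) f3)).
Proof.
apply: congruent_trans (congruentACA _ _ _ _) _.
apply: congruentM; last exact: power_bitM.
apply: congruent_trans (congruentACA _ _ _ _) _.
by apply: congruentM; apply: power_bitM.
Qed.

Lemma monomial_setM g h : monomial_set g -> monomial_set h -> monomial_set (g *
  h).
Proof.
move=> [e1 [e2 [e3 ge]]] [f1 [f2 [f3 hf]]].
exists (e1 (+) f1), (e2 (+) f2), (e3 (+) f3).
exact: congruent_trans (congruentM ge hf) (monomialM _ _ _ _ _ _).
Qed.

Lemma monomial_set_center p : B p -> monomial_set (i p).
Proof.
by move=> Bp; exists false, false, false; exists p; rewrite /monomial ?mulg1.
Qed.

(** Modulo B the monomials form a group of exponent 2. *)
Lemma monomial_set_square g : monomial_set g -> exists2 p, B p & g * g = i p.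
Proof.
move=> [e1 [e2 [e3 ge]]].
have [p Bp ->] := congruent_trans (congruentM ge ge) (monomialM _ _ _ _ _ _).
by exists p; rewrite // /monomial !addbb /= !mulg1.
Qed.

Lemma monomial_set_subloop : subloop monomial_set.
Proof.
split=> [|g h|g h Mg Mgh|g h Mh Mgh].
- by rewrite -embedding0; apply: monomial_set_center; have [] := subB.
- exact: monomial_setM.
- have [p Bp gg] := monomial_set_square Mg.
  have -> : h = i (- p)%R * (g * (g * h)) by rewrite square_centerl gg iD addNr
    i0.
  apply: monomial_setM; last exact: monomial_setM.
  exact/monomial_set_center/BN.
have [p Bp hh] := monomial_set_square Mh.
have -> : g = i (- p)%R * (g * h * h).
  by rewrite (associates_abb RA_L) hh -iC iD addNr i0.
apply: monomial_setM; last exact: monomial_setM.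
exact/monomial_set_center/BN.
Qed.

End ModuloSubgroup.
Section Coordinates.
Variables (x y u : L).
Hypothesis xyu : nonassoc x y u.

Let bit_form a b c e : nonassoc a b (power_bit c e) = e && nonassoc a b c.
Proof. by case: e => //=; rewrite /nonassoc !mulg1 eqxx. Qed.

Lemma nonassoc_monomial p e1 e2 e3 : let g := i p * monomial x y u e1 e2 e3 in
  [/\ nonassoc y u g = e1, nonassoc x u g = e2 & nonassoc x y g = e3].
Proof.
have M a b : nonassoc a b (i p * monomial x y u e1 e2 e3) =
    (e1 && nonassoc a b x) (+) (e2 && nonassoc a b y) (+) (e3 && nonassoc a b
      u).
  rewrite !(RA_nonassocM st) !bit_form -(RA_nonassoc_rot st (i p)).
  by rewrite nonassoc_center.
have yux : nonassoc y u x by rewrite -(RA_nonassoc_rot st).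
have xuy : nonassoc x u y by rewrite (RA_nonassoc_swap st) (RA_nonassoc_rot st).
rewrite /= !M !nonassoc_aba !nonassoc_abb xyu yux xuy !andbF !andbT !addbF.
by rewrite !addFb.
Qed.

Lemma monomial_inj p q e1 e2 e3 f1 f2 f3 :
  i p * monomial x y u e1 e2 e3 = i q * monomial x y u f1 f2 f3 ->
  [/\ p = q, e1 = f1, e2 = f2 & e3 = f3].
Proof.
move=> eq_g; have /= [E1 E2 E3] := nonassoc_monomial p e1 e2 e3.
have /= [F1 F2 F3] := nonassoc_monomial q f1 f2 f3.
move: (E1) (E2) (E3); rewrite eq_g F1 F2 F3 => D1 D2 D3.
split=> //; rewrite -D1 -D2 -D3 in eq_g.
exact: (center_cancel RA_L emb eq_g).
Qed.

Lemma monomial_set_embedding (B : A -> Prop) p :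
  monomial_set x y u B (i p) -> B p.
Proof.
move=> [e1 [e2 [e3 [q Bq]]]].
have {1}-> : i p = i p * monomial x y u false false false.
  by rewrite /monomial /= !mulg1.
by case/monomial_inj => -> _ _ _.
Qed.

End Coordinates.

Lemma square_double x p q : x * x = i q ->
  (i p * x) * (i p * x) = i (q + p + p)%R.
Proof.
by move=> xx; rewrite iA iCA xx -!embeddingD (addrC p q) addrCA addrA.
Qed.

(** Exchange the factors of the first x y, which costs s, and cancel from
    the inside. *)
Lemma square_mul x y p q : noncomm x y -> x * x = i p -> y * y = i q ->
  (x * y) * (x * y) = i (p + q + s)%R.
Proof.
move=> xy xx yy; rewrite {1}(RA_mulC st x y) xy iA.
have -> : y * x * (x * y) = y * (x * (x * y)).
  have : nonassoc y x (x * y) = false.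
    by rewrite (RA_nonassocM st) nonassoc_abb nonassoc_aba.
  by move/negbFE/eqP.
rewrite square_centerl xx iCA yy -!embeddingD.
by rewrite mulr1n addrC.
Qed.

Definition square_triple p q r := exists x y u,
  [/\ nonassoc x y u, x * x = i (p + s)%R, y * y = i (q + s)%R
    & u * u = i (r + s)%R].

Hypothesis indecomposable_L : loop_indecomposable L.

Lemma center_subloop (C : A -> Prop) : add_subgroup C -> subloop (i @`
  C)%classic.
Proof.
move=> [C0 CB].
have CN p : C p -> C (- p)%R by move=> Cp; rewrite -sub0r; apply: CB.
split.
- by exists 0%R; rewrite ?embedding0.
- move=> _ _ [p Cp <-] [q Cq <-]; exists (p + q)%R; last exact: embeddingD.
  by rewrite -[q]opprK; apply: CB; last exact: CN.
- move=> _ b [p Cp <-] [q Cq Eq]; exists (q - p)%R; first exact: CB.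
  apply: (loop_mulI RA_L (a := i p)).
  by rewrite -Eq -embeddingD addrC subrK.
move=> a _ [p Cp <-] [q Cq Eq]; exists (q - p)%R; first exact: CB.
apply: (loop_mulI RA_L (a := i p)).
by rewrite -embeddingD addrC subrK Eq iC.
Qed.

(** If the squares of x, y, u and s lie in B, then the monomials with
    coefficients in B form a subloop that is a complement of C in L. *)
Lemma direct_sum_trivial x y u (B C : A -> Prop) : nonassoc x y u ->
  direct_sum B C -> B s -> (exists2 p, B p & x * x = i p) ->
  (exists2 p, B p & y * y = i p) -> (exists2 p, B p & u * u = i p) ->
  forall v, C v -> v = 0%R.
Proof.
move=> xyu [subB subC genBC BC0] Bs Bx By Bu v Cv.
have [//|v0] := pselect (v = 0%R).
case: indecomposable_L; exists (monomial_set x y u B), (i @` C)%classic; split.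
- exact: monomial_set_subloop.
- exact: center_subloop.
- move=> MT; have : monomial_set x y u B (i v) by rewrite MT.
  by move/(monomial_set_embedding xyu) => Bv; apply/v0/BC0.
- move=> CT; have [p _ Ex] : (i @` C)%classic x by rewrite CT.
  by move: xyu; rewrite -Ex nonassoc_center.
have Cc : forall c, (i @` C)%classic c -> exists p, c = i p by move=> _ [p _
  <-]; exists p.
split; last first.
  move=> a a' _ _ _ _ [p _ <-] [q _ <-].
  by rewrite -(iC p) -(iC q) iA (iCA q) iD -embeddingD iC.
split.
- by move=> g _.
- case=> g c [g' c'] /set_mem[/= [e1 [e2 [e3 [b Bb ->]]]] [p Cp <-]].
  case/set_mem=> /= [[f1 [f2 [f3 [b' Bb' ->]]]] [q Cq <-]].
  rewrite -(iC p) -(iC q) !iD => /(monomial_inj xyu)[eq_bp -> -> ->].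
  have bb' : (b - b' = q - p)%R.
    by apply/eqP; rewrite subr_eq addrAC -eq_bp addrAC subrr add0r.
  have b0 : (b - b' = 0)%R.
    by apply: BC0; [have [_] := subB; apply | rewrite bb'; have [_] := subC;
      apply].
  have /eqP := b0; rewrite subr_eq0 => /eqP ->; congr (_, i _).
  by apply/esym/eqP; rewrite -subr_eq0 -bb' b0.
move=> g _; have [z [e1 [e2 [e3 ->]]]] := RA_coordinates st g xyu.
have [b [c [Bb Cc' ->]]] := genBC z.
exists (i b * monomial x y u e1 e2 e3, i c); first split=> /=.
- by exists e1, e2, e3, b.
- by exists c.
by rewrite /= -iC iD addrC.
Qed.

Lemma square_exists x : exists p, x * x = i (p + s)%R.
Proof.
by have [p xx] := RA_square st x; exists (p - s)%R; rewrite subrK.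
Qed.

Lemma square_triple_rows : row_system s square_triple.
Proof.
have s2 := RA_s2 st.
split.
- have [x [y [u xyu]]] := RA_triple st.
  have [p xx] := square_exists x; have [q yy] := square_exists y.
  by have [r uu] := square_exists u; exists p, q, r, x, y, u; split.
- move=> p q r [x [y [u [xyu xx yy uu]]]]; exists y, x, u; split=> //.
  by rewrite (RA_nonassoc_swap st).
- move=> p q r [x [y [u [xyu xx yy uu]]]]; exists x, u, y; split=> //.
  by rewrite (RA_nonassoc_swap st) (RA_nonassoc_rot st).
- move=> p q r [x [y [u [xyu xx yy uu]]]]; exists (x * y), y, u; split=> //.
    by rewrite nonassocMl nonassoc_aab xyu.
  rewrite (square_mul _ xx yy) ?(RA_nonassoc_noncomm st xyu) //.
  by congr i; rewrite -!addrA s2 addr0 (addrC s q).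
- move=> p q r d [x [y [u [xyu xx yy uu]]]]; exists (i d * x), y, u; split=> //.
    by rewrite nonassocMl nonassoc_center xyu.
  by rewrite (square_double _ xx); congr i; rewrite (addrAC p s d) (addrAC _ s).
move=> p q r B C [x [y [u [xyu xx yy uu]]]] BC Bs Bp Bq Br.
have BD v : B v -> B (v + s)%R.
  have [[_ BB] _ _ _] := BC; rewrite (_ : (v + s)%R = (v - s)%R); last first.
    by congr (_ + _)%R; apply/eqP; rewrite -addr_eq0 s2.
  by move=> Bv; apply: BB.
apply: (direct_sum_trivial xyu BC) => //; eexists; rewrite ?xx ?yy ?uu //;
  exact: BD.
Qed.

(** Write the generators of L as central multiples of monomials in x, y, u.
    The subgroup of A generated by these coefficients, by s and by the
    squares of x, y and u gives a subloop that contains the generators, so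
    it is all of A. *)
Lemma center_fin_gen : loop_fin_gen L ->
  exists n (g : 'I_n -> A), forall p, exists m, p = comb g m.
Proof.
move=> [S finS genS]; have [x [y [u xyu]]] := RA_triple st.
have [p xx] := RA_square st x; have [q yy] := RA_square st y.
have [r uu] := RA_square st u.
have /finite_seqP[ss Dss] := finS.
have [zf zfP] : {zf : L -> A & forall g, exists e1 e2 e3,
    g = i (zf g) * monomial x y u e1 e2 e3}.
  apply: (@choice _ _ (fun g z => exists e1 e2 e3,
    g = i z * monomial x y u e1 e2 e3)) => g.
  have [z [e1 [e2 [e3 Dg]]]] := RA_coordinates st g xyu.
  by exists z, e1, e2, e3.
pose gs := [:: s, p, q, r & map zf ss].
pose g (j : 'I_(size gs)) := nth 0%R gs j.
exists (size gs), g; pose B v := exists m, v = comb g m.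
have subB : add_subgroup B.
  split=> [|_ _ [m ->] [n ->]]; first by exists (fun=> 0%R); rewrite comb0.
  by exists (fun j => m j - n j)%R; rewrite combB.
have Bgs v : v \in gs -> B v.
  move=> vgs; have lt_v : (index v gs < size gs)%N by rewrite index_mem.
  exists (fun j => if j == Ordinal lt_v then 1%R else 0%R).
  by rewrite comb_single mulr1z /g /= nth_index.
have subloopM : subloop (monomial_set x y u B).
  apply: monomial_set_subloop => //; first by apply: Bgs; rewrite inE eqxx.
  - by exists p => //; apply: Bgs; rewrite !inE eqxx orbT.
  - by exists q => //; apply: Bgs; rewrite !inE eqxx !orbT.
  - by exists r => //; apply: Bgs; rewrite !inE eqxx !orbT.
move=> v; apply: (monomial_set_embedding xyu (B := B)).
have : [set: L]%classic (i v) by []; rewrite -genS; apply; split=> // h Sh.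
have [e1 [e2 [e3 Dh]]] := zfP h; exists e1, e2, e3, (zf h) => //.
apply: Bgs; rewrite !inE; do !(apply/orP; right); apply: map_f.
by move: Sh; rewrite Dss.
Qed.

End RAStructureTheory.

(** * The loop as M(G, *, u^2) *)

(** A presentation of G by its centre f A and two elements; it determines G,
    which is later known only through it. *)
Record plane_presentation (G : groupType) (A : zmodType) (f : A -> G) (s p q :
  A)
    (x y : G) : Prop := {
  plane_inj : injective f;
  plane_morph : forall a b, f (a + b)%R = f a * f b;
  plane_central : forall a g, f a * g = g * f a;
  plane_s_neq0 : s <> 0%R;
  plane_s2 : (s + s)%R = 0%R;
  plane_comm : x * y = f s * (y * x);
  plane_x2 : x * x = f p;
  plane_y2 : y * y = f q;
  plane_gen : forall g, exists a e1 e2,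
    g = f a * (power_bit x e1 * power_bit y e2)
}.

Section Model.
Variables (L : umagmaType) (A : zmodType) (i : A -> L) (s : A).
Hypothesis st : RA_structure i s.
Hypothesis RA_L : RA_loop L.
Variables (x y u : L).
Hypothesis xyu : nonassoc x y u.
Implicit Types (a b c g h : L) (p q z : A).

Let emb := RA_emb st.
Let iC := centerC emb.
Let iA := center_mulA emb.
Let iCA := center_mulCA RA_L emb.
Let iD := center_mulD emb.
Let i0 := center_mul0 emb.

(** As the associator is additive, this describes the group generated by x,
    y and the centre. *)
Definition in_plane g := ~~ nonassoc x y g.

Lemma in_planeP g : reflect
  (exists z e1 e2, g = i z * (power_bit x e1 * power_bit y e2)) (in_plane g).
Proof.
apply: (iffP idP) => [xyg|[p [f1 [f2 ->]]]].
  have [z [e1 [e2 [e3 Dg]]]] := RA_coordinates st g xyu.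
  have [_ _] := nonassoc_monomial st RA_L xyu z e1 e2 e3.
  rewrite /monomial -Dg (negPf xyg) => e3F.
  by exists z, e1, e2; rewrite Dg -e3F mulg1.
have [_ _] := nonassoc_monomial st RA_L xyu p f1 f2 false.
by rewrite /monomial mulg1 /in_plane => ->.
Qed.

Lemma in_planeM g h : in_plane g -> in_plane h -> in_plane (g * h).
Proof.
rewrite /in_plane (RA_nonassocM st) => /negPf -> /negPf ->.
by [].
Qed.

Let bit_expand (f : L -> bool) a e : f 1 = false ->
  f (power_bit a e) = e && f a.
Proof. by case: e. Qed.

Let nonassoc1 a b : nonassoc a b 1 = false.
Proof. by rewrite /nonassoc !mulg1 eqxx. Qed.

Let nonassoc_expand a b z e1 e2 :
  nonassoc a b (i z * (power_bit x e1 * power_bit y e2)) =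
    (e1 && nonassoc a b x) (+) (e2 && nonassoc a b y).
Proof.
rewrite !(RA_nonassocM st) !(bit_expand (f := nonassoc a b)) //.
by rewrite -(RA_nonassoc_rot st) (nonassoc_center st).
Qed.

(** The form nonassoc is alternating and trilinear, and in_plane has only
    two dimensions modulo the centre. *)
Lemma in_planeA g h k : in_plane g -> in_plane h -> in_plane k ->
  g * h * k = g * (h * k).
Proof.
move=> gP hP kP.
have xy a : in_plane a -> nonassoc x y a = false by move/negPf.
have yx a : in_plane a -> nonassoc y x a = false.
  by move/xy; rewrite (RA_nonassoc_swap st).
have expand a b c : in_plane c -> nonassoc a b x = false ->
    nonassoc a b y = false -> nonassoc a b c = false.
  by move=> /in_planeP[z [e1 [e2 ->]]] ax ay;
    rewrite nonassoc_expand ax ay !andbF.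
have x0 a b : in_plane a -> in_plane b -> nonassoc a b x = false.
  move=> aP bP; rewrite (RA_nonassoc_rot st) (RA_nonassoc_rot st).
  apply: expand => //; first by rewrite (nonassoc_aba st RA_L).
  by rewrite (RA_nonassoc_rot st) (RA_nonassoc_rot st) yx.
have y0 a b : in_plane a -> in_plane b -> nonassoc a b y = false.
  move=> aP bP; rewrite (RA_nonassoc_rot st) (RA_nonassoc_rot st).
  apply: expand => //; last by rewrite (nonassoc_aba st RA_L).
  by rewrite (RA_nonassoc_rot st) (RA_nonassoc_rot st) xy.
have /negbFE/eqP// : nonassoc g h k = false.
by apply: expand; rewrite ?x0 ?y0.
Qed.

Lemma in_plane_center p : in_plane (i p).
Proof. by apply/in_planeP; exists p, false, false; rewrite !mulg1. Qed.

Lemma in_plane1 : in_plane 1.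
Proof. by rewrite -(embedding0 st) in_plane_center. Qed.

(** Since the square of g is central, a central multiple of g is its
    inverse. *)
Definition opposite_square g : A := - xget 0%R [set p | g * g = i p].

Lemma opposite_squareP g : g * (i (opposite_square g) * g) = 1.
Proof.
have [p gg] := RA_square st g.
have gq : g * g = i (xget 0%R [set p | g * g = i p]).
  exact: (xgetPex 0%R (ex_intro (fun q => g * g = i q) p gg)).
rewrite iCA /opposite_square; set q := xget _ _ in gq *; clearbody q.
by rewrite gq -(embeddingD st) addNr (embedding0 st).
Qed.

Lemma plane_group : exists (G : groupType) (j : G -> L),
  [/\ injective j, forall a b : G, j (a * b) = j a * j b
    & forall g, in_plane g <-> exists t : G, j t = g].
Proof.
pose G := {g : L | in_plane g}.
have ext (g h : G) : val g = val h -> g = h by move=> eq_gh; apply: val_inj.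
pose one : G := exist _ 1 in_plane1.
pose mul (g h : G) : G := exist _ (val g * val h) (in_planeM (valP g) (valP h)).
pose inv (g : G) : G := exist _ (i (opposite_square (val g)) * val g)
  (in_planeM (in_plane_center _) (valP g)).
have mulA : associative mul.
  by move=> g h k; apply: ext => /=; rewrite in_planeA //; apply: valP.
have mul1 : left_id one mul by move=> g; apply: ext; rewrite /= mul1g.
have mulg1 : right_id one mul by move=> g; apply: ext; rewrite /= mulg1.
have mulV : right_inverse one inv mul.
  by move=> g; apply: ext; rewrite /= opposite_squareP.
have mulVl : left_inverse one inv mul.
  by move=> g; rewrite -(mulV g); apply: ext; rewrite /= iA iCA.
pose GT : groupType := HB.pack G (isGroup.Build G mulA mul1 mulg1 mulVl mulV).
exists GT, (fun g : G => val g); split=> // g.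
split=> [gP|[t <-]]; last exact: valP.
by exists (exist _ g gP).
Qed.

Lemma noncomm_expand a z e1 e2 :
  noncomm (i z * (power_bit x e1 * power_bit y e2)) a =
    (e1 && noncomm x a) (+) (e2 && noncomm y a) (+) [&& e1, e2 & nonassoc x y
      a].
Proof.
rewrite !(RA_noncommM st) (nonassoc_center st) (noncomm_center st) addbF addFb.
rewrite !(bit_expand (f := fun b => noncomm b a)) ?/noncomm ?mul1g ?mulg1 ?eqxx
  //.
congr (_ (+) _ ); case: e1; case: e2 => //=.
all: by rewrite /nonassoc ?mul1g ?mulg1 eqxx.
Qed.

Let xy1 : noncomm x y. Proof. exact: (RA_nonassoc_noncomm st xyu). Qed.

Let yu1 : noncomm y u.
Proof.
by apply: (RA_nonassoc_noncomm st (c := x)); rewrite -(RA_nonassoc_rot st).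
Qed.

Let xu1 : noncomm x u.
Proof.
apply: (RA_nonassoc_noncomm st (c := y)).
by rewrite (RA_nonassoc_swap st) (RA_nonassoc_rot st).
Qed.

Let noncomm_aa a : noncomm a a = false.
Proof. by rewrite /noncomm eqxx. Qed.

(** On the plane both sides are alternating bilinear forms, with the value
    true at (x, y). *)
Lemma nonassoc_plane a b : in_plane a -> in_plane b ->
  nonassoc a b u = noncomm a b.
Proof.
move=> /in_planeP[z [e1 [e2 ->]]] bP; rewrite noncomm_expand (negPf bP) !andbF.
rewrite (RA_nonassoc_rot st) nonassoc_expand addbF.
move: bP => /in_planeP[t [f1 [f2 ->]]]; set c := (i t * _).
have xb : noncomm x c = f2.
  rewrite noncommC noncomm_expand noncomm_aa (nonassoc_aba st RA_L) noncommC.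
  by rewrite xy1 !andbF andbT addbF.
have yb : noncomm y c = f1.
  rewrite noncommC noncomm_expand noncomm_aa (nonassoc_abb st RA_L).
  by rewrite xy1 !andbF andbT !addbF.
have xbu : nonassoc c u x = f2.
  rewrite (RA_nonassoc_rot st) nonassoc_expand (nonassoc_abb st RA_L).
  by rewrite (RA_nonassoc_rot st) xyu andbF andbT.
have ybu : nonassoc c u y = f1.
  rewrite (RA_nonassoc_rot st) nonassoc_expand (nonassoc_abb st RA_L).
  by rewrite (RA_nonassoc_rot st) (RA_nonassoc_swap st) xyu andbF andbT addbF.
by rewrite xb yb xbu ybu.
Qed.

Lemma nonassoc_plane_u g : in_plane g -> nonassoc x y (g * u).
Proof. by move=> /negPf gP; rewrite (RA_nonassocM st) gP. Qed.

Section Isomorphism.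
Variables (G : groupType) (j : G -> L) (f : A -> G) (go : A).
Hypotheses (j_inj : injective j) (jM : forall a b : G, j (a * b) = j a * j b).
Hypothesis jP : forall g, in_plane g <-> exists t : G, j t = g.
Hypotheses (jf : forall p, j (f p) = i p) (uu : u * u = i go).
Local Notation M := (Mloop (f s) (f go)).

Let j_plane t : in_plane (j t). Proof. by apply/jP; exists t. Qed.

Definition Mloop_map (m : M) : L :=
  match m with inl t => j t | inr t => j t * u end.

(** An element of the plane is central in G if and only if it commutes with
    u. *)
Lemma star_noncomm (t : G) : j (star (f s) t) = i (s *+ noncomm u (j t))%R * j
  t.
Proof.
rewrite /star; have [z [e1 [e2 Dt]]] := in_planeP _ (j_plane t).
have jx : exists tx, j tx = x.
  by apply/jP; rewrite /in_plane (nonassoc_aba st RA_L).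
have jy : exists ty, j ty = y.
  by apply/jP; rewrite /in_plane (nonassoc_abb st RA_L).
have tu : noncomm u (j t) = e1 || e2.
  rewrite noncommC Dt noncomm_expand xu1 yu1 xyu; by case: (e1); case: (e2).
case: asboolP => [[_ tC]|ntC].
  have comm g : (exists t', j t' = g) -> noncomm (j t) g = false.
    by move=> [t' <-]; rewrite /noncomm -!jM tC // eqxx.
  have := comm _ jx; have := comm _ jy.
  rewrite tu Dt !noncomm_expand !noncomm_aa xy1 (noncommC y x) xy1.
  rewrite (nonassoc_aba st RA_L) (nonassoc_abb st RA_L).
  by case: (e1); case: (e2); rewrite //= i0.
suff -> : noncomm u (j t) by rewrite jM jf.
rewrite tu; apply/negPn/negP; rewrite negb_or => /andP[/negPf e10 /negPf e20].
apply: ntC; split=> // t' _; apply: j_inj.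
by rewrite !jM Dt e10 e20 !mulg1 iC.
Qed.

Let sbit2 (e : bool) a : i (s *+ e)%R * (i (s *+ e)%R * a) = a.
Proof.
rewrite iD; case: e; first by rewrite (RA_s2 st) i0.
by rewrite mulr0n addr0 i0.
Qed.

Lemma Mloop_map_morphism (m n : M) :
  Mloop_map (m * n) = Mloop_map m * Mloop_map n.
Proof.
case: m n => t [] t'; first exact: jM.
- change (j (t' * t) * u = j t * (j t' * u)); rewrite jM.
  have := RA_mulA st (j t) (j t') u.
  rewrite {1}(RA_mulC st (j t) (j t')) iA nonassoc_plane //.
  exact: (loop_mulI RA_L).
- change (j (t * star (f s) t') * u = j t * u * j t').
  rewrite jM star_noncomm (RA_mulA st (j t) u) (RA_mulC st u (j t')).
  rewrite (iCA _ (j t) (j t')) (iCA _ (j t) (j t' * u)) iA.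
  rewrite (RA_mulA st (j t) (j t') u) (RA_nonassoc_swap st (j t) u).
  by rewrite (RA_nonassoc_rot st u) !iD (addrC (s *+ nonassoc _ _ _)%R).
change (j (f go * star (f s) t' * t) = j t * u * (j t' * u)).
rewrite !jM jf star_noncomm (RA_mulA st (j t) u) (RA_nonassocM st).
rewrite (nonassoc_abb st RA_L) addbF (RA_nonassoc_swap st (j t) u).
rewrite (RA_nonassoc_rot st u) nonassoc_plane //.
have -> : u * (j t' * u) = i (s *+ noncomm u (j t'))%R * (i go * j t').
  rewrite -(associates_aba RA_L) (RA_mulC st u (j t')) iA.
  by rewrite (associates_abb RA_L) uu (iC go).
set k := (s *+ _)%R; set v := (s *+ _)%R.
have vv a : i v * (i v * a) = a by apply: sbit2.
rewrite !iA (iCA k (j t)) (iCA go (j t)) (RA_mulC st (j t) (j t')) -/v.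
by rewrite (iD k go) (iD go k) (addrC k) -(iCA v (i _)) vv.
Qed.

Lemma Mloop_map_inj : injective Mloop_map.
Proof.
have lr t t' : j t <> j t' * u.
  by move=> eq_t; have := j_plane t; rewrite eq_t /in_plane nonassoc_plane_u.
case=> t [] t' /= eq_t.
- by congr inl; apply: j_inj.
- by case: (lr t t').
- by case: (lr t' t).
by congr inr; apply: j_inj; apply: (loop_mulIr RA_L eq_t).
Qed.

Lemma Mloop_map_surj a : exists m, Mloop_map m = a.
Proof.
case: (boolP (in_plane a)) => [/jP[t <-]|]; first by exists (inl t).
rewrite /in_plane negbK => xya.
have /jP[t Et] : in_plane (i (- go)%R * (a * u)).
  apply: in_planeM; first exact: in_plane_center.
  by rewrite /in_plane (RA_nonassocM st) xya xyu.
exists (inr t); rewrite /= Et iA (associates_abb RA_L) uu -iC iD addNr.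
by rewrite i0.
Qed.

Lemma Mloop_isomorphism : loop_isomorphic L M.
Proof.
have [k kK] : {k : L -> M & forall a, Mloop_map (k a) = a}.
  exact: (@choice _ _ (fun a m => Mloop_map m = a)) Mloop_map_surj.
exists k; first by exists Mloop_map => // m; apply: Mloop_map_inj; rewrite kK.
by move=> a b; apply: Mloop_map_inj; rewrite Mloop_map_morphism !kK.
Qed.

End Isomorphism.

Lemma plane_model p q go : x * x = i p -> y * y = i q -> u * u = i go ->
  exists (G : groupType) (f : A -> G) (x' y' : G),
    plane_presentation f s p q x' y' /\
    loop_isomorphic L (Mloop (f s) (f go)).
Proof.
move=> xx yy uu; have [G [j [j_inj jM jP]]] := plane_group.
have [f jf] : {f : A -> G & forall p, j (f p) = i p}.
  apply: (@choice _ _ (fun p t => j t = i p)) => r.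
  exact/jP/in_plane_center.
have /jP[x' jx] : in_plane x by rewrite /in_plane (nonassoc_aba st RA_L).
have /jP[y' jy] : in_plane y by rewrite /in_plane (nonassoc_abb st RA_L).
exists G, f, x', y'; split; last exact: (Mloop_isomorphism j_inj jM jP jf uu).
split.
- by move=> r t eq_rt; apply: (embedding_inj st); rewrite -!jf eq_rt.
- by move=> r t; apply: j_inj; rewrite jM !jf (embeddingD st).
- by move=> r g; apply: j_inj; rewrite !jM !jf iC.
- exact: RA_s_neq0 st.
- exact: RA_s2 st.
- by apply: j_inj; rewrite !jM jf jx jy {1}(RA_mulC st x y) xy1.
- by apply: j_inj; rewrite jM jf jx.
- by apply: j_inj; rewrite jM jf jy.
move=> g; have /in_planeP[z [e1 [e2 Dg]]] : in_plane (j g) by apply/jP;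
  exists g.
have j1 : j 1 = 1.
  by apply: (loop_mulI RA_L (a := j 1)); rewrite -jM !mulg1.
have jbit (g' : G) e : j (power_bit g' e) = power_bit (j g') e by case: e.
exists z, e1, e2; apply: j_inj.
by rewrite !jM jf !jbit jx jy.
Qed.

End Model.

Local Open Scope classical_set_scope.
Local Open Scope group_scope.

(** * Groups generated by two elements and their centre *)

(** The isomorphism sends a coset to the value of phi at a chosen member. *)
Lemma quotient_isomorphic_morphism (G H : groupType) (D N : set G) (phi : G ->
  H) :
  subgroup D -> subgroup N -> N `<=` D ->
  (forall g h, D g -> D h -> phi (g * h) = phi g * phi h) ->
  (forall g, D g -> (phi g = 1 <-> N g)) ->
  (forall h, exists2 g, D g & phi g = h) ->
  quotient_isomorphic D N H.
Proof.
move=> [D1 DM DV] [N1 NM NV] ND phiM phiN phi_surj.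
pose F (X : set G) := phi (xget 1 X).
have FE g (X : set G) : D g -> (X `<=` [set g * n | n in N])%classic ->
    X !=set0 -> F X = phi g.
  move=> Dg XgN X0; rewrite /F; have /XgN[n Nn <-] := xgetPex 1 X0.
  by rewrite phiM //; [rewrite (phiN n (ND _ Nn)).2 ?mulg1 | apply: ND].
have Fcoset g : D g -> F [set g * n | n in N] = phi g.
  by move=> Dg; apply: FE => //; exists (g * 1); exists 1.
exists F; first split.
- by [].
- move=> X Y /set_mem[g Dg <-] /set_mem[h Dh <-]; rewrite !Fcoset // => eq_gh.
  have Ngh a b : D a -> D b -> phi a = phi b -> N (a^-1 * b).
    move=> Da Db eq_ab; apply/phiN; first exact/DM/Db/DV.
    apply: (mulgI (phi a)); rewrite -phiM ?mulVKg ?mulg1 //.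
    exact/DM/Db/DV.
  apply/seteqP; split=> _ [n Nn <-].
    by exists (h^-1 * g * n); [apply: NM => //;
      apply: Ngh | rewrite !mulgA mulgV mul1g].
  by exists (g^-1 * h * n); [apply: NM => //;
    apply: Ngh | rewrite !mulgA mulgV mul1g].
- move=> h _; have [g Dg <-] := phi_surj h.
  by exists [set g * n | n in N]; [exists g | apply: Fcoset].
move=> _ _ [g Dg <-] [h Dh <-]; rewrite !Fcoset // -phiM //.
rewrite /F; set X := set_mul _ _.
have X0 : X !=set0 by exists (g * 1 * (h * 1)); exists (g * 1);
  [exists 1 | exists (h * 1) => //; exists 1].
have [_ [m Nm <-] [_ [n Nn <-] <-]] := xgetPex 1 X0.
have [Dm Dn] := (ND _ Nm, ND _ Nn).
have Dgm := DM _ _ Dg Dm; have Dhn := DM _ _ Dh Dn.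
by rewrite !phiM // (phiN m Dm).2 // (phiN n Dn).2 // !mulg1.
Qed.

Section Plane.
Variables (G : groupType) (A : zmodType) (f : A -> G) (s p q : A) (x y : G).
Hypothesis pl : plane_presentation f s p q x y.
Implicit Types (a b c : A) (g h : G) (B C : A -> Prop).

Let fC := plane_central pl.
Let s2 := plane_s2 pl.

Lemma plane_morph1 : f 0%R = 1.
Proof. by apply: (mulgI (f 0%R)); rewrite -(plane_morph pl) addr0 mulg1. Qed.

Lemma plane_morphV a : f (- a)%R = (f a)^-1.
Proof.
by apply: (mulgI (f a)); rewrite -(plane_morph pl) subrr plane_morph1 mulgV.
Qed.

Lemma plane_morphMz a (n : int) :
  f (a *~ n)%R = if (0 <= n)%R then f a ^+ `|n|%N else (f a ^+ `|n|%N)^-1.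
Proof.
have fX k : f (a *+ k)%R = f a ^+ k.
  by elim: k => [|k IHk];
    rewrite ?plane_morph1 // mulrS (plane_morph pl) IHk expgS.
case: n => k /=; first by rewrite fX.
by rewrite NegzE mulrNz plane_morphV fX.
Qed.

Definition plane_elt a e1 e2 := f a * (power_bit x e1 * power_bit y e2).

Let bitM g r e1 e2 : g * g = f r ->
  power_bit g e1 * power_bit g e2 = f (r *+ (e1 && e2))%R * power_bit g (e1 (+)
    e2).
Proof.
case: e1 e2 => [] [] /= gg; rewrite ?mulr0n ?plane_morph1 ?mul1g ?mulg1 //.
Qed.

Let bit_comm e1 e2 : power_bit y e2 * power_bit x e1 =
  f (s *+ (e1 && e2))%R * (power_bit x e1 * power_bit y e2).
Proof.
case: e1 e2 => [] [] /=; rewrite ?mulr0n ?plane_morph1 ?mul1g ?mulg1 //.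
by rewrite (plane_comm pl) mulgA -(plane_morph pl) s2 plane_morph1 mul1g.
Qed.

Let fMM a b g h : (f a * g) * (f b * h) = f (a + b)%R * (g * h).
Proof. by rewrite (plane_morph pl) -!mulgA (mulgA g) -fC -!mulgA. Qed.

Lemma plane_eltM a b e1 e2 e3 e4 : plane_elt a e1 e2 * plane_elt b e3 e4 =
  plane_elt (a + b + s *+ (e3 && e2) + (p *+ (e1 && e3) + q *+ (e2 && e4)))%R
            (e1 (+) e3) (e2 (+) e4).
Proof.
rewrite /plane_elt fMM -[_ * _ * (_ * _)]mulgA (mulgA (power_bit y e2))
  bit_comm.
rewrite -(mulgA (f _)) mulgA -fC -!(mulgA (f _)).
rewrite -!(mulgA (power_bit _ _)) (mulgA (power_bit x e1) (power_bit x e3)).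
rewrite (bitM _ _ (plane_x2 pl)) (bitM _ _ (plane_y2 pl)) fMM !mulgA.
by rewrite -!(plane_morph pl).
Qed.

Lemma plane_eltP g : exists a e1 e2, g = plane_elt a e1 e2.
Proof. exact: (plane_gen pl g). Qed.

Let fcancel a b g : f a * g = f b * g -> a = b.
Proof. by move/mulIg/(plane_inj pl). Qed.

Let s_inj (e1 e2 : bool) : (s *+ e1 = s *+ e2)%R -> e1 = e2.
Proof.
have s0 := plane_s_neq0 pl.
by case: e1 e2 => [] []; rewrite ?mulr1n ?mulr0n // => /esym.
Qed.

(** The commutator form on G modulo its centre is the determinant of the
    exponents. *)
Lemma plane_elt_commE a b e1 e2 e3 e4 : let g := plane_elt a e1 e2 in
  let h := plane_elt b e3 e4 in
  g * h = f (s *+ ((e1 && e4) (+) (e2 && e3)))%R * (h * g) /\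
  ((g * h == h * g) = ~~ ((e1 && e4) (+) (e2 && e3))).
Proof.
move=> g h; have E : g * h = f (s *+ ((e1 && e4) (+) (e2 && e3)))%R * (h * g).
  rewrite /g /h !plane_eltM /plane_elt [RHS]mulgA -(plane_morph pl).
  rewrite (addbC e3) (addbC e4) (andbC e3 e1) (andbC e4 e2) (andbC e2 e3).
  have -> : (s *+ (e3 && e2) = s *+ ((e1 && e4) (+) (e3 && e2)) + s *+ (e1 &&
    e4))%R.
    by case: (e1); case: (e2); case: (e3); case: (e4);
      rewrite /= ?addr0 ?add0r ?s2.
  congr (f _ * _); rewrite !addrA; do 3!congr (_ + _)%R.
  by rewrite addrC (addrC a) addrA.
split=> //; apply/eqP/idP => [|/negPf e0];
  last by rewrite E e0 plane_morph1 mul1g.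
rewrite E -[X in _ = X -> _]mul1g -plane_morph1 => /fcancel.
by rewrite -[X in _ = X -> _](mulr0n s) => /(@s_inj _ false) ->.
Qed.

Let Dx : x = plane_elt 0%R true false.
Proof. by rewrite /plane_elt plane_morph1 mul1g mulg1. Qed.

Let Dy : y = plane_elt 0%R false true.
Proof. by rewrite /plane_elt plane_morph1 !mul1g. Qed.

(** The exponent of x in an element can be read off from its commutator with
    y, and the other way round. *)
Definition x_bit g := g * y != y * g.
Definition y_bit g := g * x != x * g.

Lemma x_bit_elt a e1 e2 : x_bit (plane_elt a e1 e2) = e1.
Proof.
rewrite /x_bit Dy (plane_elt_commE a 0%R e1 e2 false true).2.
by rewrite andbT andbF addbF negbK.
Qed.

Lemma y_bit_elt a e1 e2 : y_bit (plane_elt a e1 e2) = e2.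
Proof.
rewrite /y_bit Dx (plane_elt_commE a 0%R e1 e2 true false).2.
by rewrite andbT andbF addFb negbK.
Qed.

Lemma plane_elt_inj a b e1 e2 e3 e4 :
  plane_elt a e1 e2 = plane_elt b e3 e4 -> [/\ a = b, e1 = e3 & e2 = e4].
Proof.
move=> eq_g; have := x_bit_elt a e1 e2; have := y_bit_elt a e1 e2.
rewrite eq_g x_bit_elt y_bit_elt => D2 D1; split=> //.
by move: eq_g; rewrite D1 D2 => /fcancel.
Qed.

Definition plane_set B : set G := [set g | exists a e1 e2, B a /\ g = plane_elt
  a e1 e2].

Lemma plane_setT : plane_set (fun=> True) = setT.
Proof.
apply/seteqP; split=> // g _; have [a [e1 [e2 ->]]] := plane_eltP g.
by exists a, e1, e2.
Qed.

Lemma plane_eltf a : f a = plane_elt a false false.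
Proof. by rewrite /plane_elt !mulg1. Qed.

(** The groups G and D of the types are both of the form plane_set B, with B
    the group of their central elements. *)
Section Subgroup.
Variable B : A -> Prop.
Hypotheses (subB : add_subgroup B) (Bs : B s) (Bp : B p) (Bq : B q).

Let B0 : B 0%R. Proof. by have [] := subB. Qed.

Let BN a : B a -> B (- a)%R.
Proof. by have [_ BB] := subB => Ba; rewrite -sub0r; apply: BB. Qed.

Let BD a b : B a -> B b -> B (a + b)%R.
Proof. by have [_ BB] := subB => Ba Bb; rewrite -[b]opprK; apply/BB/BN. Qed.

Let Bbit a (e : bool) : B a -> B (a *+ e)%R. Proof. by case: e. Qed.

Lemma plane_set_subgroup : subgroup (plane_set B).
Proof.
have DM g h : plane_set B g -> plane_set B h -> plane_set B (g * h).
  move=> [a [e1 [e2 [Ba ->]]]] [b [e3 [e4 [Bb ->]]]]; rewrite plane_eltM.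
  do 3!eexists; split; last by []; do !apply: BD => //; exact: Bbit.
split=> // [|g Dg]; first by exists 0%R, false, false;
  rewrite -plane_eltf plane_morph1.
have [a [e1 [e2 [Ba Dge]]]] := Dg.
have [c Bc gg] : exists2 c, B c & g * g = f c.
  rewrite Dge plane_eltM !addbb; eexists; last by rewrite -plane_eltf.
  by do !apply: BD => //; exact: Bbit.
have -> : g^-1 = g * f (- c)%R.
  by apply: (mulgI g); rewrite mulgV mulgA gg -(plane_morph pl) subrr
    plane_morph1.
apply: DM => //; exists (- c)%R, false, false; rewrite plane_eltf.
by split=> //; apply: BN.
Qed.

Lemma plane_set_x : plane_set B x.
Proof. by exists 0%R, true, false. Qed.

Lemma plane_set_y : plane_set B y.
Proof. by exists 0%R, false, true. Qed.

Lemma plane_set_f a : B a -> plane_set B (f a).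
Proof. by move=> Ba; exists a, false, false; rewrite plane_eltf. Qed.

Lemma plane_center : center (plane_set B) = [set f a | a in B].
Proof.
apply/seteqP; split=> [_ [[a [e1 [e2 [Ba ->]]]] gC]|_ [a Ba <-]].
  have := x_bit_elt a e1 e2; have := y_bit_elt a e1 e2.
  rewrite /x_bit /y_bit !gC ?eqxx; [|exact: plane_set_y|exact: plane_set_x].
  by move=> <- <-; exists a; rewrite // -plane_eltf.
by split=> [|g _]; [apply: plane_set_f | apply: fC].
Qed.

Lemma plane_generated :
  plane_set B = generated ([set x; y] `|` center (plane_set B)).
Proof.
apply/seteqP; split=> [_ [a [e1 [e2 [Ba ->]]]] H [[H1 HM HV] genH]|].
  apply: (HM).
    by apply: genH; right; rewrite plane_center; exists a.
  apply: (HM); first by case: e1 => //; apply: genH; left; left.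
  by case: e2 => //; apply: genH; left; right.
apply: smallest_sub; first exact: plane_set_subgroup.
move=> _ [[->|->]|[]//]; [exact: plane_set_x | exact: plane_set_y].
Qed.

Lemma plane_quotient :
  quotient_isomorphic (plane_set B) (center (plane_set B)) C2xC2.
Proof.
pose phi g : C2xC2 := ((x_bit g)%:R%R, (y_bit g)%:R%R).
have bitD (e1 e2 : bool) : ((e1 (+) e2)%:R = e1%:R + e2%:R :> 'Z_2)%R.
  by case: e1 e2 => [] []; apply: val_inj.
apply: (@quotient_isomorphic_morphism _ _ _ _ phi).
- exact: plane_set_subgroup.
- rewrite plane_center; split.
  + by exists 0%R; rewrite ?plane_morph1.
  + move=> _ _ [a Ba <-] [b Bb <-]; exists (a + b)%R; first exact: BD.
    exact: plane_morph pl _ _.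
  + move=> _ [a Ba <-]; exists (- a)%R; [exact: BN | exact: plane_morphV].
- by move=> g [].
- move=> _ _ [a [e1 [e2 [_ ->]]]] [b [e3 [e4 [_ ->]]]].
  by rewrite /phi plane_eltM !x_bit_elt !y_bit_elt !bitD.
- move=> _ [a [e1 [e2 [Ba ->]]]]; rewrite plane_center /phi x_bit_elt y_bit_elt.
  split=> [[]|[b Bb]].
    case: e1 => // _; case: e2 => // _; exists a; rewrite // -plane_eltf //.
  by rewrite plane_eltf => /plane_elt_inj[_ <- <-].
case=> h1 h2.
have bit_of (h : 'Z_2) : exists e : bool, h = e%:R%R.
  by case: h => [[|[|//]] lth]; [exists false | exists true]; apply: val_inj.
have [e1 ->] := bit_of h1; have [e2 ->] := bit_of h2.
exists (plane_elt 0%R e1 e2); first by exists 0%R, e1, e2.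
by rewrite /phi x_bit_elt y_bit_elt.
Qed.

End Subgroup.

Lemma plane_commutator : [~ x, y] = f s.
Proof.
rewrite commgEl conjgE; apply: (mulgI x); rewrite mulgA mulgV mul1g.
by apply: (mulgI y); rewrite mulgA mulgV mul1g (plane_comm pl) fC -mulgA.
Qed.

Lemma plane_derived : derived (@setT G) = [set 1; f s].
Proof.
have ff : f s * f s = 1 by rewrite -(plane_morph pl) s2 plane_morph1.
apply/seteqP; split.
  apply: smallest_sub.
    split=> [|g h|g]; first by left.
      by move=> [->|->] [->|->]; rewrite ?mul1g ?mulg1 ?ff;
        [left|right|right|left].
    move=> [->|->]; [left; exact: invg1 | right].
    by apply: (mulgI (f s)); rewrite ff mulgV.
  move=> _ [g _ [h _ <-]].
  have [a [e1 [e2 Dg]]] := plane_eltP g; have [b [e3 [e4 Dh]]] := plane_eltP h.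
  have [gh _] := plane_elt_commE a b e1 e2 e3 e4.
  have -> : [~ g, h] = f (s *+ ((e1 && e4) (+) (e2 && e3)))%R.
    rewrite commgEl conjgE; apply: (mulgI g); rewrite mulgA mulgV mul1g.
    apply: (mulgI h); rewrite mulgA mulgV mul1g.
    by rewrite {1}Dg {1}Dh gh -Dg -Dh fC -mulgA.
  by case: (_ (+) _); [right | left; rewrite mulr0n plane_morph1].
move=> _ [->|->] H [[H1 HM HV] genH]; first exact: H1.
by rewrite -plane_commutator; apply: genH; exists x => //; exists y.
Qed.

Lemma plane_datum go : Mloop_datum (f s) (f go).
Proof.
have subT : @add_subgroup A (fun=> True) by [].
have cT a : center setT (f a) by split=> // g _; apply: fC.
split=> //.
- exists x, y; rewrite (plane_comm pl) -[X in _ <> X]mul1g -plane_morph1.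
  by move/fcancel/(plane_s_neq0 pl).
- by rewrite -plane_setT; apply: plane_quotient.
- split=> //; split=> //.
    by rewrite expg2 -(plane_morph pl) s2 plane_morph1.
  case=> [|[|k]] // _; rewrite expg1 -plane_morph1 => /(plane_inj pl) s0.
  by case: (plane_s_neq0 pl).
exact: plane_derived.
Qed.

Lemma plane_cyclic a : cyclic_subgroup (f a) = [set f (a *~ n)%R | n in setT].
Proof.
apply/seteqP; split.
  apply: smallest_sub; last by move=> _ ->; exists 1%R; rewrite ?mulr1z.
  split.
  - by exists 0%R; rewrite ?mulr0z ?plane_morph1.
  - move=> _ _ [m _ <-] [n _ <-]; exists (m + n)%R => //.
    by rewrite mulrzDr (plane_morph pl).
  - by move=> _ [m _ <-]; exists (- m)%R; rewrite // mulrNz plane_morphV.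
move=> _ [n _ <-] H [[H1 HM HV] genH].
have Ha : H (f a) by apply: genH.
have HX k : H (f a ^+ k) by elim: k => [|k IHk]; rewrite ?expgS //; apply: HM.
by rewrite plane_morphMz; case: ifP => _ //; apply: HV.
Qed.

Let f_elt c a e1 e2 : f c * plane_elt a e1 e2 = plane_elt (c + a)%R e1 e2.
Proof. by rewrite /plane_elt mulgA -(plane_morph pl). Qed.

(** For the types in which D is a proper subgroup of G: a complement of the
    coefficients of D in the centre is a complement of D in G. *)
Lemma plane_dprod B C : direct_sum B C -> B s -> B p -> B q ->
  internal_dprod (plane_set B) [set f c | c in C] setT.
Proof.
move=> [subB [_ CB] gen BC0] Bs Bp Bq; split; last first.
  move=> g g' _ _ _ _ [c _ <-] [c' _ <-].
  by rewrite -!mulgA; congr (_ * _); rewrite !mulgA fC.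
split; first by [].
- case=> g c [g' c'] /set_mem[/= [a [e1 [e2 [Ba ->]]]] [b Cb <-]].
  case/set_mem=> /= [[a' [f1 [f2 [Ba' ->]]]] [b' Cb' <-]].
  rewrite /= -(fC b) -(fC b') !f_elt => /plane_elt_inj[eq_ab -> ->].
  have ab : (a - a' = b' - b)%R.
    by apply/eqP; rewrite subr_eq addrAC -eq_ab addrAC subrr add0r.
  have a0 : (a - a' = 0)%R.
    by apply: BC0; [have [_] := subB; apply | rewrite ab; apply: CB].
  have /eqP := a0; rewrite subr_eq0 => /eqP ->; congr (_, f _).
  by apply/esym/eqP; rewrite -subr_eq0 -ab a0.
move=> g _; have [z [e1 [e2 ->]]] := plane_eltP g.
have [b [c [Bb Cc ->]]] := gen z.
exists (plane_elt b e1 e2, f c); first by split; [exists b, e1, e2 | exists c].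
by rewrite /= -fC f_elt addrC.
Qed.

Section Basis.
Variables (r : nat) (e : 'I_r -> A) (o : 'I_r -> nat).
Hypothesis eo : basis e o.

Definition partial_span (ks : seq 'I_r) a :=
  exists2 c, a = comb e c & forall j, j \notin ks -> c j = 0%R.

Lemma partial_span_subgroup ks : add_subgroup (partial_span ks).
Proof.
split=> [|_ _ [c -> c0] [d -> d0]]; first by exists (fun=> 0%R); rewrite ?comb0.
exists (fun j => c j - d j)%R; first by rewrite combB.
by move=> j jks; rewrite c0 // d0 // subrr.
Qed.

Lemma plane_cyclic_dprod ks : uniq ks ->
  cyclic_dprod (map (fun j => f (e j)) ks) [set f a | a in partial_span ks].
Proof.
elim: ks => [_|k ks IHks /= /andP[kks uks]].
  apply/seteqP; split=> [_ [a [c -> c0] <-]|_ ->].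
    by rewrite (eq_comb e (d := fun=> 0%R)) ?comb0 ?plane_morph1 // => j;
      apply: c0.
  by exists 0%R; [exists (fun=> 0%R); rewrite ?comb0 | exact: plane_morph1].
exists [set f a | a in partial_span ks]; first exact: IHks.
rewrite plane_cyclic; split; last first.
  move=> _ _ b b' [m _ <-] [n _ <-] _ _.
  by rewrite -!mulgA; congr (_ * _); rewrite !mulgA fC.
split.
- case=> _ _ [/= [n _ <-] [_ [c -> c0] <-]].
  exists (e k *~ n + comb e c)%R; last exact: plane_morph pl _ _.
  exists (fun j => (if j == k then n else 0) + c j)%R.
    by rewrite -combD comb_single.
  move=> j; rewrite inE negb_or => /andP[/negPf -> jks].
  by rewrite c0 // addr0.
- case=> g g' [h h'] /set_mem[/= [m _ <-] [_ [c -> c0] <-]].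
  case/set_mem=> /= [[n _ <-] [_ [d -> d0] <-]].
  rewrite -!(plane_morph pl) => /(plane_inj pl) /eqP.
  rewrite -subr_eq0 -!comb_single !combD combB => /eqP.
  have [_ rel] := eo => /rel oc.
  congr (f _, f _).
    rewrite !comb_single; apply/eqP; rewrite -subr_eq0 -mulrzBr;
      apply/eqP/(basis_single _ _ eo).
    by have := oc k; rewrite eqxx c0 // d0 // !addr0.
  apply/eqP; rewrite -subr_eq0 combB; apply/eqP/rel => j.
  have := oc j; case: eqP => [->|_]; last by rewrite !add0r.
  by rewrite c0 // d0 // subrr dvdz0.
move=> _ [_ [c -> c0] <-].
exists (f (e k *~ c k)%R, f (comb e (fun j => if j == k then 0 else c j))%R).
  split=> /=; first by exists (c k).
  exists (comb e (fun j => if j == k then 0 else c j))%R => //.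
  exists (fun j => if j == k then 0 else c j)%R => // j jks.
  by case: eqP => // /eqP jk; apply: c0; rewrite inE negb_or jk.
rewrite /= -(plane_morph pl) -comb_single combD; congr f; apply: eq_comb => j.
by case: eqP => [->|_]; rewrite ?addr0 ?add0r.
Qed.

Lemma plane_order j : even_order (o j) -> (0 < o j)%N ->
  has_2power_order (f (e j)) (logn 2 (o j)).
Proof.
case=> [->//|[k ojk]] oj_gt0; have ojE : o j = (2 ^ logn 2 (o j))%N.
  by rewrite ojk pfactorK.
have fX n : (f (e j) ^+ n = 1) <-> (o j %| n)%N.
  have -> : f (e j) ^+ n = f (e j *~ n%:Z)%R by rewrite plane_morphMz.
  rewrite -plane_morph1; split=> [/(plane_inj pl)|on].
    by move/(basis_single _ _ eo); rewrite dvdzE.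
  by congr f; apply/(basis_single _ _ eo); rewrite dvdzE.
split; first by rewrite ojk pfactorK.
rewrite -ojE; split=> // [|n n_gt0 /fX on]; first exact/fX.
exact: dvdn_leq.
Qed.

Lemma plane_infinite_order j : o j = 0%N -> has_infinite_order (f (e j)).
Proof.
move=> oj0 n n_gt0.
have -> : f (e j) ^+ n = f (e j *~ n%:Z)%R by rewrite plane_morphMz.
rewrite -plane_morph1 => /(plane_inj pl)/(basis_single _ _ eo).
by rewrite dvdzE oj0 /= dvd0n => /eqP n0; rewrite n0 in n_gt0.
Qed.

Lemma plane_D_group i1 ks : uniq ks -> partial_span ks s -> partial_span ks p ->
  partial_span ks q -> even_order (o i1) -> (0 < o i1)%N ->
  s = (e i1 *~ (o i1)./2)%R ->
  D_group (plane_set (partial_span ks)) x y (f (e i1)) (logn 2 (o i1))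
    (map (fun j => f (e j)) ks) (f p) (f q).
Proof.
move=> uks ks_s ks_p ks_q [->//|[k oik]] oi_gt0 Ds.
have subB := partial_span_subgroup ks.
split.
- by split; [apply: plane_set_subgroup | apply: plane_generated].
- by rewrite plane_center //; apply: plane_cyclic_dprod.
- exact: plane_quotient.
- rewrite plane_commutator Ds oik pfactorK // expnS mul2n doubleK subn1.
  by rewrite plane_morphMz.
by rewrite !expg2; split; [apply: plane_x2 pl | apply: plane_y2 pl].
Qed.

End Basis.

End Plane.

(** * The sixteen types *)

Section Types.
Variables (G : groupType) (A : zmodType) (f : A -> G) (s p q : A) (x y : G).
Hypothesis pl : plane_presentation f s p q x y.
Variables (r : nat) (e : 'I_r -> A) (o : 'I_r -> nat) (i1 : 'I_r).
Hypothesis eoi : involution_basis s e o i1.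
Implicit Types (ks : seq 'I_r).

Local Notation m j := (logn 2 (o j)).
Local Notation D ks := (plane_set f x y (partial_span e ks)).

Let eo : basis e o. Proof. by have [] := eoi. Qed.

Lemma partial_spanT ks : (forall j, j \in ks) -> forall a, partial_span e ks a.
Proof.
by move=> ksT a; have [c ->] := eo.1 a; exists c => // j; rewrite ksT.
Qed.

Lemma partial_span_single ks j n : j \in ks -> partial_span e ks (e j *~ n)%R.
Proof.
move=> jks; exists (fun k => if k == j then n else 0%R).
  by rewrite comb_single.
by move=> k; case: eqP => // ->; rewrite jks.
Qed.

Lemma plane_full ks : (forall j, j \in ks) -> D ks = setT.
Proof.
move=> ksT; apply/seteqP; split=> // g _.
have [a [e1 [e2 ->]]] := plane_eltP pl g; exists a, e1, e2.
by split; first exact: partial_spanT.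
Qed.

Lemma type_order j : (0 < o j)%N -> has_2power_order (f (e j)) (m j).
Proof. by have [_ evo _ _] := eoi; exact: (plane_order pl eo (evo j)). Qed.

Lemma type_infinite j : o j = 0%N -> has_infinite_order (f (e j)).
Proof. exact: (plane_infinite_order pl eo). Qed.

Lemma type_order1 : has_2power_order (f (e i1)) (m i1).
Proof. by have [_ _ oi_gt0 _] := eoi; apply: type_order. Qed.

Lemma type_D_group ks : uniq ks -> i1 \in ks -> partial_span e ks p ->
  partial_span e ks q ->
  D_group (D ks) x y (f (e i1)) (m i1) (map (fun j => f (e j)) ks) (f p) (f q).
Proof.
move=> uks i1ks ks_p ks_q; have [_ evo oi_gt0 Ds] := eoi.
apply: (plane_D_group pl eo) => //.
by rewrite Ds; apply: partial_span_single.
Qed.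

Lemma basis_direct_sum ks k : uniq (k :: ks) -> (forall j, j \in k :: ks) ->
  direct_sum (partial_span e ks) (fun a => exists n, a = e k *~ n)%R.
Proof.
move=> /= /andP[kks uks] ksT; split.
- exact: partial_span_subgroup.
- exact: multiples_subgroup.
- move=> a; have [c ->] := eo.1 a.
  exists (comb e (fun j => if j == k then 0 else c j))%R, (e k *~ c k)%R; split.
  + exists (fun j => if j == k then 0 else c j)%R => // j jks.
    by have := ksT j; rewrite inE (negPf jks) orbF => ->.
  + by exists (c k).
  rewrite -comb_single combD; apply: eq_comb => j.
  by case: eqP => [->|_]; rewrite ?addr0 ?add0r.
move=> _ [c -> c0] [n] En; rewrite En; apply/(basis_single _ _ eo).
have /eo.2/(_ k) : comb e (fun j => c j - (if j == k then n else 0))%R = 0%R.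
  by rewrite -combB comb_single En subrr.
by rewrite eqxx c0 // sub0r dvdzE abszN.
Qed.

Lemma type_dprod ks k : uniq (k :: ks) -> (forall j, j \in k :: ks) ->
  i1 \in ks -> partial_span e ks p -> partial_span e ks q ->
  internal_dprod (D ks) (cyclic_subgroup (f (e k))) setT.
Proof.
move=> uks ksT i1ks ks_p ks_q; have [_ _ _ Ds] := eoi.
rewrite (plane_cyclic pl) (_ : [set _ | _ in _] =
    [set f c | c in (fun a => exists n, a = e k *~ n)%R]); last first.
  apply/seteqP; split=> [_ [n _ <-]|_ [_ [n ->] <-]]; last by exists n.
  by exists (e k *~ n)%R => //; exists n.
apply: (plane_dprod pl (basis_direct_sum uks ksT)) => //.
by rewrite Ds; apply: partial_span_single.
Qed.

End Types.

(** Adding s twice recovers the squares of the triple from its rows. *)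
Lemma row_model (L : umagmaType) (A : zmodType) (i : A -> L) (s : A) p q go :
  RA_structure i s -> RA_loop L ->
  square_triple i s (p + s)%R (q + s)%R (go + s)%R ->
  exists (G : groupType) (f : A -> G) (x y : G),
    plane_presentation f s p q x y /\ loop_isomorphic L (Mloop (f s) (f go)).
Proof.
move=> st RA_L [x [y [u [xyu]]]]; rewrite -!addrA (RA_s2 st) !addr0.
exact: plane_model.
Qed.

Theorem theorem4p1 (L : umagmaType) (RA_L : RA_loop L)
  (fin_gen_L : loop_fin_gen L) (indecomp_L : loop_indecomposable L) :
  exists (G : groupType) (s go : G),
    Mloop_datum s go /\ RA_type go /\ loop_isomorphic L (Mloop s go).
Proof.
have [A [i [s st]]] := RA_structure_exists RA_L.
have s_neq0 : s != 0%R by apply/eqP; apply: RA_s_neq0 st.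
have rows := square_triple_rows st RA_L indecomp_L.
have [n [g gen_g]] := center_fin_gen st RA_L fin_gen_L.
have [r [e [o [i1 [js [eps [eoi [uniq_js all_js size_js sorted_js] eps01
  T]]]]]]] :=
  row_normal_form rows s_neq0 (RA_s2 st) gen_g.
have build p q go : square_triple i s (p + s)%R (q + s)%R (go + s)%R ->
    (forall (G : groupType) (f : A -> G) (x y : G),
       plane_presentation f s p q x y -> RA_type (f go)) ->
    exists (G : groupType) (s go : G),
      Mloop_datum s go /\ RA_type go /\ loop_isomorphic L (Mloop s go).
  move=> Tpq typ; have [G [f [x [y [pl iso]]]]] := row_model st RA_L Tpq.
  exists G, (f s), (f go); split; first exact: (plane_datum pl).
  by split; first exact: typ pl.
have [_ evo oi_gt0 _] := eoi.
have fin_inf (j k : 'I_r) : ((o j == 0) <= (o k == 0))%N -> o j = 0%N -> o k =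
  0%N.
  by move=> le oj; move: le; rewrite oj eqxx; case: eqP.
have ord_or j : (0 < o j)%N \/ o j = 0%N by case: (o j) => [|k]; [right|left].
case: js uniq_js all_js size_js sorted_js T => [|j [|k [|l [|? ?]]]] //=.
- move=> _ all1 _ _ T; apply: build T _ => G f x y pl.
  have DT := plane_full pl eoi all1.
  have span := partial_spanT eoi all1.
  have Dg := type_D_group pl eoi (isT : uniq [:: i1]) (all1 i1) (span _) (span
    _).
  have := type_order1 pl eoi; case: eps01 Dg => -> Dg to1.
    rewrite !(plane_morph1 pl) in Dg *.
    exact: RA_type1 to1 Dg DT erefl.
  exact: RA_type2 to1 Dg DT erefl.
- move=> uj allj _ _ T; apply: build (row_swapl rows T) _ => G f x y pl.
  have DT := plane_full pl eoi allj.
  have span := partial_spanT eoi allj.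
  have Dg := type_D_group pl eoi (uj : uniq [:: i1;
    j]) (mem_head _ _) (span _) (span _).
  have to1 := type_order1 pl eoi.
  have [/(type_order pl eoi) toj|/(type_infinite pl eoi) toj] := ord_or j.
    case: eps01 Dg => -> Dg; last exact: RA_type4 to1 toj Dg DT erefl.
    by rewrite !(plane_morph1 pl) in Dg *; apply: RA_type3 to1 toj Dg DT erefl.
  case: eps01 Dg => -> Dg; last exact: RA_type6 to1 toj Dg DT erefl.
  by rewrite !(plane_morph1 pl) in Dg *; apply: RA_type5 to1 toj Dg DT erefl.
- move=> ujk alljk _ /andP[le_jk _] T; apply: build T _ => G f x y pl.
  have DT := plane_full pl eoi alljk.
  have span := partial_spanT eoi alljk.
  have Dg := type_D_group pl eoi (ujk : uniq [:: i1; j;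
    k]) (mem_head _ _) (span _) (span _).
  have to1 := type_order1 pl eoi.
  have [oj|oj] := ord_or j; last first.
    have toj := type_infinite pl eoi oj.
    have tok := type_infinite pl eoi (fin_inf _ _ le_jk oj).
    case: eps01 Dg => -> Dg; last exact: RA_type15 to1 toj tok Dg DT erefl.
    by rewrite !(plane_morph1 pl) in Dg *;
      apply: RA_type14 to1 toj tok Dg DT erefl.
  have toj := type_order pl eoi oj.
  have [/(type_order pl eoi) tok|/(type_infinite pl eoi) tok] := ord_or k.
    case: eps01 Dg => -> Dg; last exact: RA_type8 to1 toj tok Dg DT erefl.
    by rewrite !(plane_morph1 pl) in Dg *;
      apply: RA_type7 to1 toj tok Dg DT erefl.
  case: eps01 Dg => -> Dg; last exact: RA_type11 to1 toj tok Dg DT erefl.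
  by rewrite !(plane_morph1 pl) in Dg *;
    apply: RA_type10 to1 toj tok Dg DT erefl.
move=> ujkl alljkl _ /and3P[le_jk le_kl _] T.
have span1 ks a : a \in ks -> partial_span e ks (e a).
  by move=> aks; rewrite -[e a]mulr1z; apply: partial_span_single.
have perm3 (a b c : 'I_r) : perm_eq [:: i1; j; k; l] [:: c; i1; a; b] ->
    [/\ uniq [:: c; i1; a; b], forall h, h \in [:: c; i1; a; b]
      & uniq [:: i1; a; b]].
  move=> pm; have uc : uniq [:: c; i1; a; b] by rewrite -(perm_uniq pm).
  split=> // [h|]; first by rewrite -(perm_mem pm).
  by case/andP: uc.
have typeD a b c : perm_eq [:: i1; j; k; l] [:: c; i1; a; b] ->
    forall (G : groupType) (f : A -> G) (x y : G),
    plane_presentation f s (e a) (e b) x y ->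
    D_group (plane_set f x y (partial_span e [:: i1; a; b])) x y (f (e i1))
      (logn 2 (o i1)) [:: f (e i1); f (e a); f (e b)] (f (e a)) (f (e b)) /\
    internal_dprod (plane_set f x y (partial_span e [:: i1; a; b]))
      (cyclic_subgroup (f (e c))) setT.
  move=> /perm3[uc allc uab] G f x y pl; have in1 := mem_head i1 [:: a; b].
  have [in_a in_b] : a \in [:: i1; a; b] /\ b \in [:: i1; a; b].
    by rewrite !inE !eqxx !orbT.
  split; first exact: (type_D_group pl eoi uab in1 (span1 _ _ in_a) (span1 _ _
    in_b)).
  exact: (type_dprod pl eoi uc allc in1 (span1 _ _ in_a) (span1 _ _ in_b)).
have permjkl : perm_eq [:: i1; j; k; l] [:: l; i1; j; k].
  by apply/permP => P /=; lia.
have permjlk : perm_eq [:: i1; j; k; l] [:: k; i1; j; l].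
  by apply/permP => P /=; lia.
have [oj|oj] := ord_or j; last first.
  have ok := fin_inf _ _ le_jk oj; have ol := fin_inf _ _ le_kl ok.
  apply: build T _ => G f x y pl;
    have [Dg dp] := typeD _ _ _ permjkl _ _ _ _ pl.
  exact: RA_type16 (type_order1 pl eoi) (type_infinite pl eoi oj)
    (type_infinite pl eoi ok) (type_infinite pl eoi ol) Dg dp erefl.
have [ok|ok] := ord_or k; last first.
  have ol := fin_inf _ _ le_kl ok.
  apply: build T _ => G f x y pl;
    have [Dg dp] := typeD _ _ _ permjkl _ _ _ _ pl.
  exact: RA_type13 (type_order1 pl eoi) (type_order pl eoi oj)
    (type_infinite pl eoi ok) (type_infinite pl eoi ol) Dg dp erefl.
have [ol|ol] := ord_or l.
  apply: build T _ => G f x y pl;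
    have [Dg dp] := typeD _ _ _ permjkl _ _ _ _ pl.
  exact: RA_type9 (type_order1 pl eoi) (type_order pl eoi oj)
    (type_order pl eoi ok) (type_order pl eoi ol) Dg dp erefl.
apply: build (row_swapr rows T) _ => G f x y pl.
have [Dg dp] := typeD _ _ _ permjlk _ _ _ _ pl.
exact: RA_type12 (type_order1 pl eoi) (type_order pl eoi oj)
  (type_infinite pl eoi ol) (type_order pl eoi ok) Dg dp erefl.
Qed.
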